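(* Let $\Phi\colon\mathbb{R}\to\mathbb{R}$ satisfy: (i) $\Phi$ is strictly convex, differentiable, and $\Phi(x)/|x|\to\infty$ as $|x|\to\infty$; (ii) $\Phi(0)=\Phi'(0)=0$; (iii) $(\Phi')^{-1}\colon\mathbb{R}\to\mathbb{R}$ is continuously differentiable; (iv) there is a constant $k_\Phi>1$ such that $k_\Phi\Phi(x)\le \Phi'(x)x$ for all $x\in\mathbb{R}$. Let $f\colon[0,1]\times\mathbb{R}\times\mathbb{R}\to\mathbb{R}$ be continuous and satisfy: (v) there is a constant $R>0$ such that $x f(t,x,0)>0$ for all $t\in[0,1]$ and all $x\in\mathbb{R}$ with $|x|>R$; (vi) there are positive functions $S,T\colon[0,1]\times\mathbb{R}\to\mathbb{R}$, bounded on bounded sets, such that $|f(t,x,v)|\le S(t,x)\,(\Phi'(v)v-\Phi(v))+T(t,x)$ for all $(t,x,v)\in[0,1]\times\mathbb{R}\times\mathbb{R}$. Let $(BC)$ be one of the following boundary conditions, where $A,B\in\mathbb{R}$: (1) Dirichlet: $u(0)=A$, $u(1)=B$; (2) Sturm-Liouville: $-\alpha u(0)+\beta\dot u(0)=A$ and $a u(1)+b\dot u(1)=B$, with constants $\alpha,\beta,a,b>0$. Then the boundary value problem $$\frac{d}{dt}\Phi'(\dot u)=f(t,u,\dot u),\quad t\in[0,1],\qquad u \text{ satisfies } (BC),$$ has at least one solution.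
   Context: A dot denotes $d/dt$. Under (i), $\Phi'$ is an increasing homeomorphism of $\mathbb{R}$ onto $\mathbb{R}$, so $(\Phi')^{-1}$ in (iii) is well defined. A solution is a function $u\in C^1([0,1],\mathbb{R})$ satisfying the boundary conditions such that $t\mapsto\Phi'(\dot u(t))$ is continuously differentiable on $[0,1]$ and $\frac{d}{dt}\Phi'(\dot u(t))=f(t,u(t),\dot u(t))$ for all $t\in[0,1]$. *)

(* Defs.v *)
From Stdlib Require Import Reals.
From Coquelicot Require Import Coquelicot.

Open Scope R_scope.

Definition strictly_convex (g : R -> R) : Prop :=
  forall x y s : R, x <> y -> 0 < s < 1 ->
    g ((1 - s) * x + s * y) < (1 - s) * g x + s * g y.

Definition is_inverse_fun (psi g : R -> R) : Prop :=
  (forall x, psi (g x) = x) /\ (forall y, g (psi y) = y).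

Definition continuously_differentiable (g : R -> R) : Prop :=
  (forall x, ex_derive g x) /\ (forall x, continuous (Derive g) x).

Definition unit_interval (t : R) : Prop := 0 <= t <= 1.

(** [D_in] is the derivative relative to the domain, hence one-sided at the
    endpoints 0 and 1; the values of [u] and [du] outside [0,1] play no role. *)
Definition C1_on_unit_interval (u du : R -> R) : Prop :=
  (forall t, unit_interval t -> D_in u du unit_interval t) /\
  continuous_on unit_interval du.

Definition bounded_set {V : NormedModule R_AbsRing} (E : V -> Prop) : Prop :=
  exists M : R, forall p, E p -> norm p <= M.

Definition bounded_on_bounded_sets {V : NormedModule R_AbsRing}
    (D : V -> Prop) (g : V -> R) : Prop :=
  forall E : V -> Prop, (forall p, E p -> D p) -> bounded_set E ->
    exists K : R, forall p, E p -> Rabs (g p) <= K.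

Definition dirichlet (A B : R) (u du : R -> R) : Prop :=
  u 0 = A /\ u 1 = B.

Definition sturm_liouville (alpha beta a b A B : R) (u du : R -> R) : Prop :=
  - alpha * u 0 + beta * du 0 = A /\ a * u 1 + b * du 1 = B.

Definition is_solution (Phi : R -> R) (f : R -> R -> R -> R)
    (BC : (R -> R) -> (R -> R) -> Prop) (u : R -> R) : Prop :=
  exists du dw : R -> R,
    C1_on_unit_interval u du /\
    BC u du /\
    C1_on_unit_interval (fun t => Derive Phi (du t)) dw /\
    (forall t, unit_interval t -> dw t = f t (u t) (du t)).

(* Main.v *)
Require Import Defs.
From Stdlib Require Import Reals Lra Lia Classical.
From Coquelicot Require Import Coquelicot.
From mathcomp Require boolp filter.

Open Scope R_scope.

(** With [psi] the inverse of [Derive Phi] and [w = Derive Phi u'], the equation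
    is the planar system [u' = psi w], [w' = f t u (psi w)]. Clamping [t], [u],
    [w] makes the right-hand side bounded, and the boundary value problem is
    then solved by shooting on [w 0]: the endpoint of the explicit Euler polygon
    depends continuously on [w 0], so for each step size some polygon meets the
    boundary condition exactly, and the pointwise limit of these polygons along
    an ultrafilter satisfies the system. A maximum principle bounds [u] on the
    limit. Along it the Legendre transform [H] of [Phi] has [H' = psi], so
    [d/dt H w = u' w'] and the growth condition controls the variation of
    [ln (S0 H w + T0)] by that of [u] between zeros of [u']; the resulting bound
    on [w] shows that the clamping was inactive. *)

(** Since [f] is only continuous, an initial value problem may have several solutions, so [w 0] does
    not determine the endpoint and the intermediate value theorem cannot be applied to the
    differential equation itself. On a polygon the endpoint is a function of the starting value,
    which is why the shooting takes place there. Along an ultrafilter every bounded sequence of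
    reals converges, so pointwise limits exist at all times at once; a Lipschitz bound common to all
    polygons supplies the uniformity needed to differentiate the limit. The order of the constants
    avoids a circle. The bound [W] on [w] depends on [M], [S0], [T0] and [Phi] alone. It fixes the
    bound [K] of the clamped [f], [K] fixes the shooting interval, and that interval fixes a
    separate clamp for [w] in the first equation, so wide that no polygon started in the interval
    leaves it. Hence [u' = psi w] is exact throughout, and only the clamps on [u] and on [w] inside
    [f] have to be removed by a priori bounds. *)

(** * Limits along a free ultrafilter *)

Lemma exists_free_ultrafilter :
  exists U : (nat -> Prop) -> Prop,
    ProperFilter U /\ filter_le U eventually /\
    forall P, U P \/ U (fun n => ~ P n).
Proof.
  (* The ultrafilter lemma is stated for the filter classes of mathcomp, so the filter axioms are
     carried over to them and back. *)
  assert (Hev : filter.ProperFilter (eventually : (nat -> Prop) -> Prop)).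
  { constructor.
    - intros [N HN]. exact (HN N (Nat.le_refl N)).
    - constructor.
      + exists 0%nat. intros n _. exact I.
      + intros P Q HP HQ. exact (filter_and (F := eventually) P Q HP HQ).
      + intros P Q HPQ. exact (filter_imp (F := eventually) P Q HPQ). }
  destruct (filter.ultraFilterLemma Hev) as [U [HU Hle]].
  exists U.
  pose proof (@filter.ultra_proper _ _ HU) as HP.
  pose proof (@filter.filter_filter _ _ HP) as HF.
  assert (Himp : forall P Q : nat -> Prop, (forall n, P n -> Q n) -> U P -> U Q)
    by (intros P Q HPQ; exact (@filter.filterS _ _ HF P Q HPQ)).
  split; [constructor | split].
  - intros P HUP. apply NNPP. intros Hn.
    apply (@filter.filter_not_empty _ U HP).
    apply (Himp P); [|exact HUP].
    intros n Pn. apply Hn. now exists n.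
  - constructor.
    + exact (@filter.filterT _ _ HF).
    + intros P Q HUP HUQ. exact (@filter.filterI _ _ HF P Q HUP HUQ).
    + exact Himp.
  - intros P. exact (Hle P).
  - intros P. exact (filter.in_ultra_setVsetC P HU).
Qed.

Lemma filterlim_eps {T : Type} (F : (T -> Prop) -> Prop) (u : T -> R) (l : R) :
  Filter F ->
  (filterlim u F (locally l) <->
   forall eps, 0 < eps -> F (fun n => Rabs (u n - l) < eps)).
Proof.
  intros HF. split; intros H.
  - intros eps Heps.
    apply (H (fun x => Rabs (x - l) < eps)).
    exists (mkposreal eps Heps). intros y Hy. exact Hy.
  - intros P [eps HP]. unfold filtermap.
    generalize (H eps (cond_pos eps)). apply filter_imp.
    intros n Hn. now apply HP.
Qed.

(** The limit is the supremum of the levels [x] with [x <= u n] for [U]-almost all [n]; the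
    dichotomy turns the failure of a bound on a large set into the opposite bound on a large set. *)
Lemma ultralimit_exists (U : (nat -> Prop) -> Prop) (u : nat -> R) (B : R) :
  ProperFilter U -> (forall P, U P \/ U (fun n => ~ P n)) ->
  U (fun n => Rabs (u n) <= B) ->
  exists l, filterlim u U (locally l).
Proof.
  intros HU Hultra HB.
  destruct (completeness (fun x => U (fun n => x <= u n))) as [l [Hub Hlub]].
  - exists B. intros x Hx.
    destruct (filter_ex _ (filter_and _ _ HB Hx)) as [n [H1 H2]].
    apply Rabs_le_between in H1. lra.
  - exists (- B). generalize HB. apply filter_imp.
    intros n Hn. apply Rabs_le_between in Hn. lra.
  - exists l. apply filterlim_eps; [typeclasses eauto|]. intros eps Heps.
    assert (Hlow : U (fun n => l - eps < u n)).
    { destruct (Hultra (fun n => l - eps < u n)) as [H|H]; [exact H|].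
      exfalso.
      enough (l <= l - eps) by lra.
      apply Hlub. intros x Hx.
      destruct (filter_ex _ (filter_and _ _ H Hx)) as [n [H1 H2]]. lra. }
    destruct (Hultra (fun n => l + eps / 2 <= u n)) as [H|H].
    + exfalso. apply Hub in H. lra.
    + generalize (filter_and _ _ Hlow H). apply filter_imp.
      intros n [H1 H2]. apply Rabs_def1; lra.
Qed.

(** * Euler polygons and their ultralimits *)

Definition continuous3 (q : R -> R -> R -> R) : Prop :=
  forall t x y eps, 0 < eps ->
    exists delta, 0 < delta /\
      forall t' x' y', Rabs (t' - t) < delta -> Rabs (x' - x) < delta ->
        Rabs (y' - y) < delta -> Rabs (q t' x' y' - q t x y) < eps.

Fixpoint euler (p q : R -> R -> R -> R) (h x0 y0 : R) (i : nat) : R * R :=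
  match i with
  | O => (x0, y0)
  | S j => let X := euler p q h x0 y0 j in
           (fst X + h * p (INR j * h) (fst X) (snd X),
            snd X + h * q (INR j * h) (fst X) (snd X))
  end.

(** A discrete mean value inequality: the slope errors of single steps add up. *)
Lemma increment_bound (z : nat -> R) (h r e : R) (i k : nat) :
  (forall j, (i <= j < i + k)%nat -> Rabs (z (S j) - z j - h * r) <= h * e) ->
  Rabs (z (i + k)%nat - z i - INR k * h * r) <= INR k * h * e.
Proof.
  induction k as [|k IH]; intros H.
  - rewrite Nat.add_0_r. simpl INR.
    replace (z i - z i - 0 * h * r) with 0 by ring.
    rewrite Rabs_R0. lra.
  - rewrite Nat.add_succ_r, S_INR.
    assert (H1 := IH (fun j Hj => H j ltac:(lia))).
    assert (H2 := H (i + k)%nat ltac:(lia)).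
    replace (z (S (i + k)) - z i - (INR k + 1) * h * r)
      with ((z (i + k)%nat - z i - INR k * h * r)
            + (z (S (i + k)) - z (i + k)%nat - h * r)) by ring.
    eapply Rle_trans; [apply Rabs_triang|]. lra.
Qed.

Lemma increment_bound_le (z : nat -> R) (h K : R) (i j : nat) :
  (forall k, Rabs (z (S k) - z k) <= h * K) ->
  (i <= j)%nat ->
  Rabs (z j - z i) <= (INR j - INR i) * h * K.
Proof.
  intros H Hij.
  replace j with (i + (j - i))%nat by lia.
  rewrite plus_INR.
  replace (INR i + INR (j - i) - INR i) with (INR (j - i)) by ring.
  replace (z (i + (j - i))%nat - z i)
    with (z (i + (j - i))%nat - z i - INR (j - i) * h * 0) by ring.
  apply increment_bound.
  intros k _. rewrite Rmult_0_r, Rminus_0_r. apply H.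
Qed.

(** Points to the last grid time before or at [t] for the step [/ INR (S n)]; [Rmax] supplies the
    nonnegativity that [nfloor_ex] asks for. *)
Definition grid_index (n : nat) (t : R) : nat :=
  proj1_sig (nfloor_ex (Rmax t 0 * INR (S n))
    (Rmult_le_pos _ _ (Rmax_r t 0) (pos_INR (S n)))).

Lemma grid_index_spec (n : nat) (t : R) :
  0 <= t ->
  INR (grid_index n t) * / INR (S n) <= t < (INR (grid_index n t) + 1) * / INR (S n).
Proof.
  intros Ht. unfold grid_index. destruct (nfloor_ex _ _) as [m [H1 H2]]. simpl proj1_sig.
  rewrite Rmax_left in H1, H2 by exact Ht.
  assert (Hn := lt_0_INR (S n) ltac:(lia)).
  split.
  - apply (Rmult_le_reg_r (INR (S n))); [exact Hn|].
    rewrite Rmult_assoc, Rinv_l, Rmult_1_r; lra.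
  - apply (Rmult_lt_reg_r (INR (S n))); [exact Hn|].
    rewrite Rmult_assoc, Rinv_l, Rmult_1_r; lra.
Qed.

Lemma grid_index_unique (n k : nat) (t : R) :
  t = INR k * / INR (S n) -> grid_index n t = k.
Proof.
  intros Ht.
  assert (Hn := lt_0_INR (S n) ltac:(lia)).
  assert (Hi := Rinv_0_lt_compat _ Hn).
  assert (Hk := pos_INR k).
  destruct (grid_index_spec n t) as [H1 H2].
  { rewrite Ht. apply Rmult_le_pos; lra. }
  rewrite Ht in H1, H2.
  apply Rmult_le_reg_r in H1; [|exact Hi].
  apply Rmult_lt_reg_r in H2; [|exact Hi].
  rewrite <- S_INR in H2.
  rewrite <- Ht in H1, H2.
  apply INR_le in H1. apply INR_lt in H2. lia.
Qed.

Lemma grid_index_mono (n : nat) (s t : R) :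
  0 <= s <= t -> (grid_index n s <= grid_index n t)%nat.
Proof.
  intros Hst.
  assert (Hi := Rinv_0_lt_compat _ (lt_0_INR (S n) ltac:(lia))).
  destruct (grid_index_spec n s) as [H1 _]; [lra|].
  destruct (grid_index_spec n t) as [_ H2]; [lra|].
  assert (H : INR (grid_index n s) * / INR (S n) < (INR (grid_index n t) + 1) * / INR (S n)) by lra.
  apply Rmult_lt_reg_r in H; [|exact Hi].
  rewrite <- S_INR in H. apply INR_lt in H. lia.
Qed.

Lemma step_eventually_small (U : (nat -> Prop) -> Prop) (d : R) :
  filter_le U eventually -> 0 < d -> U (fun n => / INR (S n) < d).
Proof.
  intros HU Hd. apply HU.
  destruct (archimed_cor1 d Hd) as [N [HN HN0]].
  exists N. intros n Hn.
  apply Rle_lt_trans with (2 := HN).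
  apply Rinv_le_contravar; [now apply lt_0_INR|]. apply le_INR. lia.
Qed.

(** Step slopes that are uniformly close to [r] near [t0] add up between the grid indices of [s] and
    [t]. For fixed [s] and [t] a single good [n] then transfers the estimate to [z], up to an
    arbitrary [e]. The conclusion is strict differentiability at [t0]. *)
Lemma slope_of_ultralimit (U : (nat -> Prop) -> Prop) (Z : nat -> nat -> R)
    (z : R -> R) (t0 r : R) :
  ProperFilter U -> filter_le U eventually ->
  (forall t, 0 <= t -> filterlim (fun n => Z n (grid_index n t)) U (locally (z t))) ->
  (forall eps, 0 < eps -> exists d, 0 < d /\
     U (fun n => forall i, Rabs (INR i * / INR (S n) - t0) < d ->
          Rabs (Z n (S i) - Z n i - / INR (S n) * r) <= / INR (S n) * eps)) ->
  forall eps, 0 < eps -> exists d, 0 < d /\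
    forall s t, 0 <= s <= t -> Rabs (s - t0) < d -> Rabs (t - t0) < d ->
      Rabs (z t - z s - (t - s) * r) <= (t - s) * eps.
Proof.
  intros HU Hev Hlim Hstep eps Heps.
  destruct (Hstep eps Heps) as [d [Hd HUd]].
  exists (d / 2). split; [lra|]. intros s t Hst Hs Ht.
  apply Rabs_def2 in Hs. apply Rabs_def2 in Ht.
  apply le_epsilon. intros e He.
  (* [e] pays for the two limit errors, each below [c], and for the mismatch between grid times and
     [s], [t], which is at most [h < c] and enters with the factors [eps] and [Rabs r]. *)
  set (c := e / (eps + Rabs r + 3)).
  assert (Hr := Rabs_pos r).
  assert (Hc : 0 < c) by (unfold c; apply Rdiv_lt_0_compat; lra).
  assert (Hce : c * (eps + Rabs r + 3) = e) by (unfold c; field; lra).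
  assert (Lt := proj1 (filterlim_eps U _ _ _) (Hlim t ltac:(lra)) c Hc).
  assert (Ls := proj1 (filterlim_eps U _ _ _) (Hlim s ltac:(lra)) c Hc).
  assert (Hh := step_eventually_small U (Rmin c (d / 2)) Hev ltac:(apply Rmin_pos; lra)).
  destruct (filter_ex _ (filter_and _ _ HUd (filter_and _ _ Hh (filter_and _ _ Lt Ls))))
    as [n [Hn [Hhn [Htn Hsn]]]].
  assert (Hh1 := Rmin_l c (d / 2)). assert (Hh2 := Rmin_r c (d / 2)).
  assert (Hi := Rinv_0_lt_compat _ (lt_0_INR (S n) ltac:(lia))).
  set (h := / INR (S n)) in *.
  assert (Gs := grid_index_spec n s ltac:(lra)).
  assert (Gt := grid_index_spec n t ltac:(lra)).
  assert (Gm := grid_index_mono n s t Hst).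
  fold h in Gs, Gt.
  set (i := grid_index n s) in *. set (j := grid_index n t) in *.
  assert (Hinc := increment_bound (Z n) h r eps i (j - i)%nat).
  replace (i + (j - i))%nat with j in Hinc by lia.
  rewrite minus_INR in Hinc by exact Gm.
  assert (Hinc' : Rabs (Z n j - Z n i - (INR j - INR i) * h * r) <= (INR j - INR i) * h * eps).
  { apply Hinc. intros k Hk. apply Hn.
    assert (K1 : INR i <= INR k) by (apply le_INR; lia).
    assert (K2 : INR k + 1 <= INR j) by (rewrite <- S_INR; apply le_INR; lia).
    apply Rabs_def1; nra. }
  clear Hinc.
  assert (Hgap : Rabs ((INR j - INR i) * h - (t - s)) <= h) by (apply Rabs_le; nra).
  set (D := (INR j - INR i) * h) in *.
  replace (z t - z s - (t - s) * r) with
    ((Z n j - Z n i - D * r) + (D - (t - s)) * r - (Z n j - z t) + (Z n i - z s)) by ring.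
  eapply Rle_trans; [apply Rabs_triang|].
  eapply Rle_trans; [apply Rplus_le_compat_r, Rabs_triang|].
  rewrite Rabs_Ropp.
  eapply Rle_trans; [apply Rplus_le_compat_r, Rplus_le_compat_r, Rabs_triang|].
  rewrite Rabs_mult.
  assert (Rabs (D - (t - s)) * Rabs r <= c * Rabs r) by (apply Rmult_le_compat_r; lra).
  apply Rabs_le_between in Hgap.
  assert (D * eps <= (t - s) * eps + c * eps) by nra.
  lra.
Qed.

(* Extending linearly to the left of 0 makes the derivative at 0 two-sided. *)
Lemma is_derive_linear_extension (z : R -> R) (r0 t0 r : R) :
  0 <= t0 -> (t0 = 0 -> r = r0) ->
  (forall eps, 0 < eps -> exists d, 0 < d /\
    forall s t, 0 <= s <= t -> Rabs (s - t0) < d -> Rabs (t - t0) < d ->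
      Rabs (z t - z s - (t - s) * r) <= (t - s) * eps) ->
  is_derive (fun t => z (Rmax t 0) + Rmin t 0 * r0) t0 r.
Proof.
  intros Ht0 Hr0 H. apply is_derive_Reals. intros eps Heps.
  destruct (H (eps / 2) ltac:(lra)) as [d [Hd Hz]].
  assert (Hd' : exists d', 0 < d' <= d /\ (0 < t0 -> d' <= t0)).
  { destruct (Req_dec t0 0) as [E|E].
    - exists d. lra.
    - exists (Rmin d t0). split; [split|intros _; apply Rmin_r].
      + apply Rmin_pos; lra.
      + apply Rmin_l. }
  destruct Hd' as [d' [[Hd'0 Hd'd] Hd't]].
  exists (mkposreal d' Hd'0). simpl. intros k Hk Hkd.
  rewrite (Rmax_left t0 0), (Rmin_right t0 0) by lra.
  assert (Hk' := Rabs_pos_lt k Hk).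
  apply Rle_lt_trans with (eps / 2); [|lra].
  apply (Rmult_le_reg_r (Rabs k)); [exact Hk'|].
  rewrite <- Rabs_mult.
  apply Rabs_def2 in Hkd.
  destruct (Rle_lt_dec 0 (t0 + k)) as [Hp|Hn].
  - rewrite (Rmax_left (t0 + k) 0), (Rmin_right (t0 + k) 0) by lra.
    match goal with |- Rabs ?e <= _ =>
      replace e with (z (t0 + k) - z t0 - k * r) by (field; exact Hk) end.
    destruct (Rle_lt_dec 0 k) as [Hk0|Hk0].
    + rewrite (Rabs_pos_eq k) by lra.
      generalize (Hz t0 (t0 + k)).
      replace (t0 + k - t0) with k by ring.
      rewrite Rminus_diag, Rabs_R0, (Rabs_pos_eq k) by lra.
      intros G. specialize (G ltac:(lra) ltac:(lra) ltac:(lra)). lra.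
    + rewrite (Rabs_left k) by lra.
      generalize (Hz (t0 + k) t0).
      replace (t0 + k - t0) with k by ring.
      replace (t0 - (t0 + k)) with (- k) by ring.
      rewrite Rminus_diag, Rabs_R0, (Rabs_left k) by lra.
      intros G. specialize (G ltac:(lra) ltac:(lra) ltac:(lra)).
      rewrite <- Rabs_Ropp.
      replace (- (z (t0 + k) - z t0 - k * r)) with (z t0 - z (t0 + k) - - k * r) by ring. lra.
  - assert (E : t0 = 0).
    { destruct Ht0 as [Ht0|Ht0]; [|now symmetry]. specialize (Hd't Ht0). lra. }
    subst t0.
    rewrite (Rmax_right (0 + k) 0), (Rmin_left (0 + k) 0) by lra.
    rewrite (Hr0 eq_refl).
    match goal with |- Rabs ?e <= _ =>
      replace e with 0 by (field; exact Hk) end.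
    rewrite Rabs_R0. apply Rmult_le_pos; lra.
Qed.

Lemma filterlim_eventually_bounded (U : (nat -> Prop) -> Prop) (u : nat -> R) (l : R) :
  Filter U -> filterlim u U (locally l) ->
  U (fun n => Rabs (u n) <= Rabs l + 1).
Proof.
  intros HU H.
  generalize (proj1 (filterlim_eps U _ _ HU) H 1 Rlt_0_1). apply filter_imp.
  intros n Hn. apply Rlt_le.
  replace (u n) with (l + (u n - l)) by ring.
  eapply Rle_lt_trans; [apply Rabs_triang|]. lra.
Qed.

(** The common Lipschitz bound confines the values at time [t] to a fixed interval, so that each
    pointwise ultralimit exists. *)
Lemma ultralimit_on_grid (U : (nat -> Prop) -> Prop) (Z : nat -> nat -> R) (a K : R) :
  ProperFilter U -> filter_le U eventually -> (forall P, U P \/ U (fun n => ~ P n)) ->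
  0 <= K ->
  filterlim (fun n => Z n O) U (locally a) ->
  (forall n i, Rabs (Z n (S i) - Z n i) <= / INR (S n) * K) ->
  exists z : R -> R,
    z 0 = a /\
    (forall t, 0 <= t -> filterlim (fun n => Z n (grid_index n t)) U (locally (z t))).
Proof.
  intros HU Hev Hultra HK Ha HZ.
  assert (Hex : forall t, 0 <= t -> exists l, filterlim (fun n => Z n (grid_index n t)) U (locally l)).
  { intros t Ht. apply (ultralimit_exists U _ (Rabs a + 1 + t * K)); try assumption.
    generalize (filterlim_eventually_bounded U _ _ _ Ha). apply filter_imp.
    intros n Hn.
    assert (G := increment_bound_le (Z n) (/ INR (S n)) K 0 (grid_index n t) (HZ n) ltac:(lia)).
    destruct (grid_index_spec n t Ht) as [G1 _].
    simpl (INR 0) in G. rewrite Rminus_0_r in G.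
    assert (INR (grid_index n t) * / INR (S n) * K <= t * K) by (apply Rmult_le_compat_r; lra).
    replace (Z n (grid_index n t)) with (Z n O + (Z n (grid_index n t) - Z n O)) by ring.
    eapply Rle_trans; [apply Rabs_triang|]. lra. }
  (* Choice asks for a total relation; negative times get the default value 0. *)
  assert (Hex' : forall t, exists l, 0 <= t ->
             filterlim (fun n => Z n (grid_index n t)) U (locally l)).
  { intros t. destruct (Rle_lt_dec 0 t) as [Ht|Ht].
    - destruct (Hex t Ht) as [l Hl]. now exists l.
    - exists 0. intros H. lra. }
  destruct (boolp.choice Hex') as [z Hz]. exists z. split; [|exact Hz].
  apply (filterlim_locally_unique (F := U) (fun n => Z n O)).
  - eapply filterlim_ext; [|exact (Hz 0 (Rle_refl 0))].
    intros n. simpl. f_equal. apply grid_index_unique. simpl. ring.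
  - exact Ha.
Qed.

(** Near [t0] all polygon points lie close to [(x t0, y t0)], so by continuity of [p] and [q] all
    their step slopes are close to the values there. The last two clauses carry the boundary
    condition at time 1 to the limit. *)
Lemma euler_ultralimit (U : (nat -> Prop) -> Prop) (p q : R -> R -> R -> R) (K : R)
    (x0 y0 : nat -> R) (a b : R) :
  ProperFilter U -> filter_le U eventually -> (forall P, U P \/ U (fun n => ~ P n)) ->
  continuous3 p -> continuous3 q ->
  (forall t x y, Rabs (p t x y) <= K) -> (forall t x y, Rabs (q t x y) <= K) ->
  filterlim x0 U (locally a) -> filterlim y0 U (locally b) ->
  exists x y : R -> R,
    x 0 = a /\ y 0 = b /\
    (forall t, 0 <= t -> is_derive x t (p t (x t) (y t))) /\
    (forall t, 0 <= t -> is_derive y t (q t (x t) (y t))) /\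
    filterlim (fun n => fst (euler p q (/ INR (S n)) (x0 n) (y0 n) (S n))) U (locally (x 1)) /\
    filterlim (fun n => snd (euler p q (/ INR (S n)) (x0 n) (y0 n) (S n))) U (locally (y 1)).
Proof.
  intros HU Hev Hultra Cp Cq Bp Bq Ha Hb.
  assert (HK : 0 <= K) by (eapply Rle_trans; [apply Rabs_pos | apply (Bp 0 0 0)]).
  assert (Hh : forall n, 0 < / INR (S n))
    by (intros n; apply Rinv_0_lt_compat, lt_0_INR; lia).
  pose (X n i := fst (euler p q (/ INR (S n)) (x0 n) (y0 n) i)).
  pose (Y n i := snd (euler p q (/ INR (S n)) (x0 n) (y0 n) i)).
  assert (EX : forall n i, X n (S i) - X n i = / INR (S n) * p (INR i * / INR (S n)) (X n i) (Y n i))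
    by (intros n i; unfold X, Y; cbn [euler fst snd]; ring).
  assert (EY : forall n i, Y n (S i) - Y n i = / INR (S n) * q (INR i * / INR (S n)) (X n i) (Y n i))
    by (intros n i; unfold X, Y; cbn [euler fst snd]; ring).
  assert (LX : forall n i, Rabs (X n (S i) - X n i) <= / INR (S n) * K).
  { intros n i. rewrite EX, Rabs_mult, (Rabs_pos_eq (/ _)) by (apply Rlt_le, Hh).
    apply Rmult_le_compat_l; [apply Rlt_le, Hh | apply Bp]. }
  assert (LY : forall n i, Rabs (Y n (S i) - Y n i) <= / INR (S n) * K).
  { intros n i. rewrite EY, Rabs_mult, (Rabs_pos_eq (/ _)) by (apply Rlt_le, Hh).
    apply Rmult_le_compat_l; [apply Rlt_le, Hh | apply Bq]. }
  destruct (ultralimit_on_grid U X a K HU Hev Hultra HK Ha LX) as [x [Hx0 Hx]].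
  destruct (ultralimit_on_grid U Y b K HU Hev Hultra HK Hb LY) as [y [Hy0 Hy]].
  (* Convergence at the single time [t0] controls all indices nearby: the grid times differ by less
     than [2 * d], one [d] for the distance to [t0] and one for the step size. *)
  assert (Near : forall (Z : nat -> nat -> R) n t0 i d c,
      (forall n i, Rabs (Z n (S i) - Z n i) <= / INR (S n) * K) ->
      0 <= t0 -> / INR (S n) < d ->
      Rabs (INR i * / INR (S n) - t0) < d ->
      Rabs (Z n (grid_index n t0) - c) < d ->
      Rabs (Z n i - c) < 2 * d * K + d).
  { intros Z n t0 i d c LZ Ht0 Hn Hi Hc.
    destruct (grid_index_spec n t0 Ht0) as [G1 G2].
    apply Rabs_def2 in Hi.
    assert (G : Rabs (Z n i - Z n (grid_index n t0)) <= 2 * d * K).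
    { destruct (Nat.le_ge_cases i (grid_index n t0)) as [Hle|Hle].
      - rewrite Rabs_minus_sym.
        eapply Rle_trans; [exact (increment_bound_le (Z n) _ K _ _ (LZ n) Hle)|].
        apply Rmult_le_compat_r; lra.
      - eapply Rle_trans; [exact (increment_bound_le (Z n) _ K _ _ (LZ n) Hle)|].
        apply Rmult_le_compat_r; lra. }
    replace (Z n i - c) with ((Z n i - Z n (grid_index n t0)) + (Z n (grid_index n t0) - c)) by ring.
    eapply Rle_lt_trans; [apply Rabs_triang|]. lra. }
  assert (Slope : forall (g : R -> R -> R -> R) (Z : nat -> nat -> R),
    continuous3 g ->
    (forall n i, Z n (S i) - Z n i = / INR (S n) * g (INR i * / INR (S n)) (X n i) (Y n i)) ->
    forall t0, 0 <= t0 -> forall eps, 0 < eps -> exists d, 0 < d /\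
     U (fun n => forall i, Rabs (INR i * / INR (S n) - t0) < d ->
          Rabs (Z n (S i) - Z n i - / INR (S n) * g t0 (x t0) (y t0)) <= / INR (S n) * eps)).
  { intros g Z Cg EZ t0 Ht0 eps Heps.
    destruct (Cg t0 (x t0) (y t0) eps Heps) as [delta [Hdelta Hg]].
    (* Chosen so that the bound [2 * d * K + d] of [Near] equals [delta]. *)
    set (d := delta / (2 * K + 1)).
    assert (Hd : 0 < d) by (unfold d; apply Rdiv_lt_0_compat; lra).
    assert (Hdd : 2 * d * K + d = delta) by (unfold d; field; lra).
    assert (0 <= 2 * d * K) by (apply Rmult_le_pos; lra).
    exists d. split; [exact Hd|].
    assert (H1 := proj1 (filterlim_eps U _ _ _) (Hx t0 Ht0) d Hd).
    assert (H2 := proj1 (filterlim_eps U _ _ _) (Hy t0 Ht0) d Hd).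
    assert (H3 := step_eventually_small U d Hev Hd).
    generalize (filter_and _ _ H1 (filter_and _ _ H2 H3)). apply filter_imp.
    intros n [G1 [G2 G3]] i Hi.
    rewrite EZ, <- Rmult_minus_distr_l, Rabs_mult, (Rabs_pos_eq (/ _)) by (apply Rlt_le, Hh).
    apply Rmult_le_compat_l; [apply Rlt_le, Hh|]. apply Rlt_le, Hg.
    - lra.
    - rewrite <- Hdd. now apply (Near X n t0 i).
    - rewrite <- Hdd. now apply (Near Y n t0 i). }
  pose (ext (z : R -> R) r t := z (Rmax t 0) + Rmin t 0 * r).
  assert (Eext : forall z r t, 0 <= t -> ext z r t = z t).
  { intros z r t Ht. unfold ext. rewrite Rmax_left, Rmin_right by exact Ht. ring. }
  exists (ext x (p 0 a b)), (ext y (q 0 a b)).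
  (* Time 1 is itself a grid point, so the last vertex of the polygon converges to the value of the
     limit at 1. *)
  assert (End : forall n, grid_index n 1 = S n).
  { intros n. apply grid_index_unique. rewrite Rinv_r; [reflexivity|].
    apply not_0_INR. lia. }
  rewrite !Eext by lra.
  split; [exact Hx0|]. split; [exact Hy0|]. split; [|split; [|split]].
  - intros t Ht. rewrite !Eext by exact Ht.
    apply is_derive_linear_extension; [exact Ht | |].
    + intros ->. now rewrite Hx0, Hy0.
    + apply (slope_of_ultralimit U X); try assumption. now apply Slope.
  - intros t Ht. rewrite !Eext by exact Ht.
    apply is_derive_linear_extension; [exact Ht | |].
    + intros ->. now rewrite Hx0, Hy0.
    + apply (slope_of_ultralimit U Y); try assumption. now apply Slope.
  - eapply filterlim_ext; [|exact (Hx 1 Rle_0_1)].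
    intros n. cbv beta. now rewrite End.
  - eapply filterlim_ext; [|exact (Hy 1 Rle_0_1)].
    intros n. cbv beta. now rewrite End.
Qed.

(** * Shooting *)

Lemma continuous3_comp (q : R -> R -> R -> R) (t s : R) (x y : R -> R) :
  continuous3 q -> continuous x s -> continuous y s ->
  continuous (fun s => q t (x s) (y s)) s.
Proof.
  intros Cq Cx Cy. apply filterlim_eps; [typeclasses eauto|]. intros eps Heps.
  destruct (Cq t (x s) (y s) eps Heps) as [d [Hd H]].
  generalize (filter_and _ _
    (proj1 (filterlim_eps (locally s) x (x s) _) Cx d Hd)
    (proj1 (filterlim_eps (locally s) y (y s) _) Cy d Hd)).
  apply filter_imp. intros r [H1 H2]. apply H; try assumption.
  now rewrite Rminus_diag, Rabs_R0.
Qed.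

Lemma euler_continuous (p q : R -> R -> R -> R) (h : R) (u0 : R -> R) (i : nat) :
  continuous3 p -> continuous3 q -> (forall s, continuous u0 s) ->
  forall s, continuous (fun s => fst (euler p q h (u0 s) s i)) s /\
            continuous (fun s => snd (euler p q h (u0 s) s i)) s.
Proof.
  intros Cp Cq Cu s. induction i as [|i [IHx IHy]].
  - split; [apply Cu | apply continuous_id].
  - cbn [euler fst snd]. split.
    + apply (continuous_plus (fun s => fst (euler p q h (u0 s) s i))); [exact IHx|].
      apply (continuous_scal_r h (fun s => p (INR i * h)
        (fst (euler p q h (u0 s) s i)) (snd (euler p q h (u0 s) s i)))).
      now apply continuous3_comp.
    + apply (continuous_plus (fun s => snd (euler p q h (u0 s) s i))); [exact IHy|].
      apply (continuous_scal_r h (fun s => q (INR i * h)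
        (fst (euler p q h (u0 s) s i)) (snd (euler p q h (u0 s) s i)))).
      now apply continuous3_comp.
Qed.

(** The curve [(u0 s, s)] of initial states encodes the left boundary condition and the zero set of
    [g] the right one. The sign change is required for every step size because the intermediate
    value theorem is used before the limit is taken. *)
Lemma shooting (p q : R -> R -> R -> R) (K : R) (u0 : R -> R) (g : R -> R -> R) (s1 s2 : R) :
  continuous3 p -> continuous3 q ->
  (forall t x y, Rabs (p t x y) <= K) -> (forall t x y, Rabs (q t x y) <= K) ->
  (forall s, continuous u0 s) ->
  (forall z : R * R, continuous (fun z => g (fst z) (snd z)) z) ->
  s1 <= s2 ->
  (forall n, let X := euler p q (/ INR (S n)) (u0 s1) s1 (S n) in g (fst X) (snd X) <= 0) ->
  (forall n, let X := euler p q (/ INR (S n)) (u0 s2) s2 (S n) in 0 <= g (fst X) (snd X)) ->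
  exists (s : R) (x y : R -> R),
    s1 <= s <= s2 /\
    x 0 = u0 s /\ y 0 = s /\ g (x 1) (y 1) = 0 /\
    (forall t, 0 <= t -> is_derive x t (p t (x t) (y t))) /\
    (forall t, 0 <= t -> is_derive y t (q t (x t) (y t))).
Proof.
  intros Cp Cq Bp Bq Cu Cg Hs H1 H2.
  destruct exists_free_ultrafilter as [U [HU [Hev Hultra]]].
  pose (G n s := let X := euler p q (/ INR (S n)) (u0 s) s (S n) in g (fst X) (snd X)).
  assert (HG : forall n, exists s, s1 <= s <= s2 /\ G n s = 0).
  { intros n.
    destruct (IVT_gen (G n) s1 s2 0) as [s [Hs' HGs]].
    - intros s. apply continuity_pt_filterlim.
      destruct (euler_continuous p q (/ INR (S n)) u0 (S n) Cp Cq Cu s) as [Cx Cy].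
      exact (continuous_comp_2 _ _ g s Cx Cy (Cg _)).
    - unfold G. split.
      + eapply Rle_trans; [apply Rmin_l | apply H1].
      + eapply Rle_trans; [apply H2 | apply Rmax_r].
    - exists s. rewrite Rmin_left, Rmax_right in Hs' by exact Hs. now split. }
  destruct (boolp.choice HG) as [sn Hsn].
  destruct (ultralimit_exists U sn (Rabs s1 + Rabs s2) HU Hultra) as [s Hlim].
  { apply filter_forall. intros n. destruct (Hsn n) as [Hn _].
    assert (A1 := Rle_abs s1). assert (A2 := Rle_abs s2).
    assert (A3 := Rle_abs (- s1)). assert (A4 := Rle_abs (- s2)).
    rewrite Rabs_Ropp in A3, A4. apply Rabs_le.
    assert (A5 := Rabs_pos s1). assert (A6 := Rabs_pos s2). lra. }
  destruct (euler_ultralimit U p q K (fun n => u0 (sn n)) sn (u0 s) s) as [x [y H]];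
    try assumption.
  { exact (filterlim_comp _ _ _ sn u0 U (locally s) (locally (u0 s)) Hlim (Cu s)). }
  destruct H as [Hx0 [Hy0 [Dx [Dy [Lx Ly]]]]].
  exists s, x, y. split; [|split; [exact Hx0|split; [exact Hy0|split; [|split; assumption]]]].
  - split.
    + apply Rnot_lt_le. intros Hlt.
      destruct (filter_ex _ (proj1 (filterlim_eps U _ _ _) Hlim (s1 - s) ltac:(lra))) as [n Hn].
      destruct (Hsn n) as [Hn' _]. apply Rabs_def2 in Hn. lra.
    + apply Rnot_lt_le. intros Hlt.
      destruct (filter_ex _ (proj1 (filterlim_eps U _ _ _) Hlim (s - s2) ltac:(lra))) as [n Hn].
      destruct (Hsn n) as [Hn' _]. apply Rabs_def2 in Hn. lra.
  - apply (filterlim_locally_unique (F := U) (fun _ : nat => 0)).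
    + eapply filterlim_ext with (f := fun n => G n (sn n)).
      { intros n. apply Hsn. }
      refine (filterlim_comp _ _ _ (fun n => euler p q (/ INR (S n)) (u0 (sn n)) (sn n) (S n))
        (fun z => g (fst z) (snd z)) U (locally (x 1, y 1)) _ _ (Cg (x 1, y 1))).
      intros P [eps HP]. unfold filtermap.
      pose proof (Lx _ (locally_ball (x 1) eps)) as Bx.
      pose proof (Ly _ (locally_ball (y 1) eps)) as By.
      unfold filtermap in Bx, By.
      generalize (filter_and _ _ Bx By).
      apply filter_imp. intros n [B1 B2]. apply HP. now split.
    + apply filterlim_const.
Qed.

(** * Maximum principle *)

Lemma is_derive_pos_increasing_at (z : R -> R) (t r : R) :
  is_derive z t r -> 0 < r ->
  exists d, 0 < d /\ forall k, 0 < k < d -> z (t - k) < z t < z (t + k).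
Proof.
  intros Hz Hr. apply is_derive_Reals in Hz.
  destruct (Hz r Hr) as [[d Hd] H]. simpl in H.
  exists d. split; [exact Hd|]. intros k Hk. split.
  - assert (G := H (- k) ltac:(lra)).
    rewrite Rabs_Ropp, Rabs_pos_eq in G by lra. specialize (G ltac:(lra)).
    apply Rabs_def2 in G.
    replace (t + - k) with (t - k) in G by ring.
    assert (E : (z (t - k) - z t) / - k = (z t - z (t - k)) / k) by (field; lra).
    rewrite E in G.
    assert (P : 0 < (z t - z (t - k)) / k * k) by (apply Rmult_lt_0_compat; lra).
    replace ((z t - z (t - k)) / k * k) with (z t - z (t - k)) in P by (field; lra). lra.
  - assert (G := H k ltac:(lra)).
    rewrite Rabs_pos_eq in G by lra. specialize (G ltac:(lra)).
    apply Rabs_def2 in G.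
    assert (P : 0 < (z (t + k) - z t) / k * k) by (apply Rmult_lt_0_compat; lra).
    replace ((z (t + k) - z t) / k * k) with (z (t + k) - z t) in P by (field; lra). lra.
Qed.

Lemma is_derive_continuity_pt (z : R -> R) (t r : R) :
  is_derive z t r -> continuity_pt z t.
Proof.
  intros Hz. apply derivable_continuous_pt. exists r. now apply is_derive_Reals.
Qed.

(** At a maximum above [M] the endpoint conditions leave only an interior time, where [w] vanishes
    and increases; then [u' = psi w] is positive just to the right, which contradicts maximality.
    The argument uses [w] instead of a second derivative of [u], since the latter may vanish at the
    maximum when [psi] is flat at 0. *)
Lemma maximum_principle (psi u w q : R -> R) (M : R) :
  (forall y, 0 < y -> 0 < psi y) -> (forall y, psi y = 0 -> y = 0) ->
  (forall t, 0 <= t <= 1 -> is_derive u t (psi (w t))) ->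
  (forall t, 0 <= t <= 1 -> is_derive w t (q t)) ->
  (forall t, 0 <= t <= 1 -> M < u t -> w t = 0 -> 0 < q t) ->
  (M < u 0 -> 0 < psi (w 0)) -> (M < u 1 -> psi (w 1) < 0) ->
  forall t, 0 <= t <= 1 -> u t <= M.
Proof.
  intros Hpos Hzero Du Dw Hq H0 H1 t Ht.
  destruct (continuity_ab_maj u 0 1 Rle_0_1) as [t0 [Hmax Ht0]].
  { intros c Hc. exact (is_derive_continuity_pt _ _ _ (Du c Hc)). }
  eapply Rle_trans; [now apply Hmax|]. apply Rnot_lt_le. intros Hlt.
  assert (Hright : t0 < 1 -> psi (w t0) <= 0).
  { intros Hlt1. apply Rnot_lt_le. intros Hp.
    destruct (is_derive_pos_increasing_at _ _ _ (Du t0 Ht0) Hp) as [d [Hd Hinc]].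
    set (k := Rmin (d / 2) (1 - t0)).
    assert (Hk1 : k <= d / 2) by apply Rmin_l.
    assert (Hk2 : k <= 1 - t0) by apply Rmin_r.
    assert (Hk0 : 0 < k) by (apply Rmin_pos; lra).
    assert (A1 := Hinc k ltac:(lra)). assert (A2 := Hmax (t0 + k) ltac:(lra)). lra. }
  assert (Hleft : 0 < t0 -> 0 <= psi (w t0)).
  { intros Hlt0. apply Rnot_lt_le. intros Hp.
    assert (D := is_derive_opp _ _ _ (Du t0 Ht0)).
    destruct (is_derive_pos_increasing_at _ _ _ D) as [d [Hd Hinc]];
      [change (0 < - psi (w t0)); lra|].
    set (k := Rmin (d / 2) t0).
    assert (Hk1 : k <= d / 2) by apply Rmin_l.
    assert (Hk2 : k <= t0) by apply Rmin_r.
    assert (Hk0 : 0 < k) by (apply Rmin_pos; lra).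
    assert (A1 := Hinc k ltac:(lra)). assert (A2 := Hmax (t0 - k) ltac:(lra)).
    destruct A1 as [A1 _]. change (- u (t0 - k) < - u t0) in A1. lra. }
  assert (Hlt0 : 0 < t0).
  { destruct (proj1 Ht0) as [|E]; [assumption|]. rewrite <- E in Hlt, Hright.
    specialize (H0 Hlt). specialize (Hright Rlt_0_1). lra. }
  assert (Hlt1 : t0 < 1).
  { destruct (proj2 Ht0) as [|E]; [assumption|]. rewrite E in Hlt, Hleft.
    specialize (H1 Hlt). specialize (Hleft Rlt_0_1). lra. }
  assert (Ew : w t0 = 0) by (apply Hzero; specialize (Hleft Hlt0); specialize (Hright Hlt1); lra).
  destruct (is_derive_pos_increasing_at _ _ _ (Dw t0 Ht0) (Hq t0 Ht0 Hlt Ew)) as [d [Hd Hinc]].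
  set (k := Rmin (d / 2) (1 - t0)).
  assert (Hk1 : k <= d / 2) by apply Rmin_l.
  assert (Hk2 : k <= 1 - t0) by apply Rmin_r.
  assert (Hk0 : 0 < k) by (apply Rmin_pos; lra).
  destruct (MVT_cor2 u (fun t => psi (w t)) t0 (t0 + k)) as [c [Ec Hc]]; [lra| |].
  { intros c Hc. apply is_derive_Reals, Du. lra. }
  assert (Wc : 0 < psi (w c)).
  { apply Hpos. assert (A1 := Hinc (c - t0) ltac:(lra)).
    replace (t0 + (c - t0)) with c in A1 by ring. lra. }
  assert (A2 := Hmax (t0 + k) ltac:(lra)).
  assert (0 < psi (w c) * (t0 + k - t0)) by (apply Rmult_lt_0_compat; lra).
  lra.
Qed.

(** * Energy estimate *)

Lemma last_point_below_le (g : R -> R) (a b c : R) :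
  a <= b -> (forall t, a <= t <= b -> continuity_pt g t) -> g a <= c ->
  exists s, a <= s <= b /\ g s <= c /\ forall r, s < r <= b -> c < g r.
Proof.
  intros Hab Hg Ha.
  destruct (completeness (fun s => a <= s <= b /\ g s <= c)) as [l [Hub Hlub]].
  { exists b. intros s [Hs _]. lra. }
  { exists a. split; [lra | exact Ha]. }
  assert (Hl : a <= l <= b).
  { split; [apply Hub; split; [lra|exact Ha] | apply Hlub; intros s [Hs _]; lra]. }
  exists l. split; [exact Hl|]. split.
  - apply Rnot_lt_le. intros Hlt.
    destruct (Hg l Hl (g l - c) ltac:(lra)) as [d [Hd H]].
    enough (l <= l - d) by lra.
    apply Hlub. intros s [Hs Hgs]. apply Rnot_lt_le. intros Hsl.
    assert (s <= l) by (apply Hub; now split).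
    destruct (Req_dec s l) as [->|Hne]; [lra|].
    assert (G : Rabs (g s - g l) < g l - c).
    { apply (H s). split.
      - split; [exact I | intros E; now apply Hne].
      - simpl. unfold Rdist. apply Rabs_def1; lra. }
    apply Rabs_def2 in G. lra.
  - intros r Hr. apply Rnot_le_lt. intros Hle.
    assert (r <= l) by (apply Hub; split; [lra|exact Hle]). lra.
Qed.

(** In [energy_bound] the target time may lie on either side of the starting time; the case [b < a]
    is reduced to the other by reflecting time. *)
Lemma last_point_below (g : R -> R) (a b c : R) :
  (forall t, Rmin a b <= t <= Rmax a b -> continuity_pt g t) -> g a <= c ->
  exists s, Rmin a b <= s <= Rmax a b /\ g s <= c /\
    forall r, Rmin s b < r < Rmax s b -> c < g r.
Proof.
  intros Hg Ha. destruct (Rle_lt_dec a b) as [Hab|Hab].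
  - rewrite Rmin_left, Rmax_right in * by lra.
    destruct (last_point_below_le g a b c Hab Hg Ha) as [s [Hs [Hgs H]]].
    exists s. split; [exact Hs|]. split; [exact Hgs|].
    intros r. rewrite Rmin_left, Rmax_right by lra. intros Hr. apply H. lra.
  - rewrite Rmin_right, Rmax_left in * by lra.
    destruct (last_point_below_le (fun t => g (- t)) (- a) (- b) c) as [s [Hs [Hgs H]]].
    + lra.
    + intros t Ht. apply (continuity_pt_comp Ropp g).
      * apply (derivable_continuous_pt Ropp). apply derivable_pt_opp, derivable_pt_id.
      * apply Hg. lra.
    + now rewrite Ropp_involutive.
    + exists (- s). split; [lra|]. split; [exact Hgs|].
      intros r. rewrite Rmin_right, Rmax_left by lra. intros Hr.
      rewrite <- (Ropp_involutive r). apply H. lra.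
Qed.


(* Cauchy's mean value theorem for [ln (S0 * H (w t) + T0)] and [u]. *)
Lemma log_energy_variation (psi H u w q : R -> R) (S0 T0 a b : R) :
  0 < S0 -> 0 < T0 ->
  (forall y, is_derive H y (psi y)) -> (forall y, 0 <= H y) ->
  a < b ->
  (forall t, a <= t <= b -> is_derive u t (psi (w t))) ->
  (forall t, a <= t <= b -> is_derive w t (q t)) ->
  (forall t, a <= t <= b -> Rabs (q t) <= S0 * H (w t) + T0) ->
  (forall t, a < t < b -> psi (w t) <> 0) ->
  Rabs (ln (S0 * H (w b) + T0) - ln (S0 * H (w a) + T0)) <= S0 * Rabs (u b - u a).
Proof.
  intros HS HT DH PH Hab Du Dw Hq Hne.
  set (L t := ln (S0 * H (w t) + T0)).
  change (Rabs (L b - L a) <= S0 * Rabs (u b - u a)).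
  assert (PG : forall t, 0 < S0 * H (w t) + T0).
  { intros t. assert (A := Rmult_le_pos _ _ (Rlt_le _ _ HS) (PH (w t))). lra. }
  assert (DL : forall t, a <= t <= b ->
     is_derive L t (S0 * (q t * psi (w t)) / (S0 * H (w t) + T0))).
  { intros t Ht. unfold L.
    evar_last.
    - apply (is_derive_comp ln (fun t => S0 * H (w t) + T0)).
      + apply is_derive_ln, PG.
      + apply (is_derive_plus (fun t => S0 * H (w t)) (fun _ => T0)).
        * apply is_derive_scal. apply (is_derive_comp H w); [apply DH | now apply Dw].
        * apply (is_derive_const (V := R_NormedModule)).
    - unfold scal, plus, zero; simpl. unfold mult; simpl. field.
      apply Rgt_not_eq, PG. }
  destruct (MVT_cor2 (fun t => (L b - L a) * u t - (u b - u a) * L t)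
    (fun t => (L b - L a) * psi (w t)
              - (u b - u a) * (S0 * (q t * psi (w t)) / (S0 * H (w t) + T0))) a b Hab)
    as [c [Ec Hc]].
  { intros t Ht. apply is_derive_Reals.
    apply (is_derive_minus (fun t => (L b - L a) * u t) (fun t => (u b - u a) * L t)).
    - now apply is_derive_scal, Du.
    - now apply is_derive_scal, DL. }
  assert (Pc := PG c). assert (Nc := Hne c Hc). assert (Qc := Hq c ltac:(lra)).
  set (g := S0 * H (w c) + T0) in *.
  (* Both derivatives contain the factor [psi (w c)], which cancels because it is nonzero; what
     remains, [q c / g], is at most 1 in absolute value by the growth bound. *)
  assert (E : (L b - L a) = (u b - u a) * (S0 * (q c / g))).
  { apply (Rmult_eq_reg_r (psi (w c) * (b - a))).
    - enough (E : (L b - L a) * psi (w c) - (u b - u a) * (S0 * (q c * psi (w c)) / g) = 0).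
      { replace ((u b - u a) * (S0 * (q c / g)) * (psi (w c) * (b - a)))
          with ((u b - u a) * (S0 * (q c * psi (w c)) / g) * (b - a)) by (field; lra). nra. }
      apply (Rmult_eq_reg_r (b - a)); [|lra].
      rewrite <- Ec. ring.
    - apply Rmult_integral_contrapositive_currified; [exact Nc | lra]. }
  rewrite E, Rabs_mult, Rabs_mult, (Rabs_pos_eq S0) by lra.
  assert (Rabs (q c / g) <= 1).
  { unfold Rdiv. rewrite Rabs_mult, Rabs_inv, (Rabs_pos_eq g) by lra.
    apply (Rmult_le_reg_r g); [exact Pc|]. rewrite Rmult_assoc, Rinv_l; lra. }
  rewrite (Rmult_comm S0 (Rabs (u b - u a))).
  apply Rmult_le_compat_l; [apply Rabs_pos|].
  rewrite <- (Rmult_1_r S0) at 2. apply Rmult_le_compat_l; lra.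
Qed.

(** The mean value theorem gives a time [t1] with [u' = u 1 - u 0], hence with energy at most [C].
    On the way from [t1] to [t], after the last time with energy at most [C], the derivative [u']
    cannot vanish, so the logarithmic estimate applies up to [t] and costs at most
    [S0 * (2 * M)]. *)
Lemma energy_bound (psi H u w q : R -> R) (S0 T0 M C : R) :
  0 < S0 -> 0 < T0 ->
  (forall y, is_derive H y (psi y)) -> (forall y, 0 <= H y) ->
  (forall y, Rabs (psi y) <= 2 * M -> H y <= C) ->
  (forall t, 0 <= t <= 1 -> Rabs (u t) <= M) ->
  (forall t, 0 <= t <= 1 -> is_derive u t (psi (w t))) ->
  (forall t, 0 <= t <= 1 -> is_derive w t (q t)) ->
  (forall t, 0 <= t <= 1 -> Rabs (q t) <= S0 * H (w t) + T0) ->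
  forall t, 0 <= t <= 1 ->
    S0 * H (w t) + T0 <= (S0 * C + T0) * exp (S0 * (2 * M)).
Proof.
  intros HS HT DH PH HC Hu Du Dw Hq t Ht.
  assert (Hdu : forall a b, 0 <= a <= 1 -> 0 <= b <= 1 -> Rabs (u b - u a) <= 2 * M).
  { intros a b Ha Hb. assert (A1 := Hu a Ha). assert (A2 := Hu b Hb).
    apply Rabs_le_between in A1. apply Rabs_le_between in A2. apply Rabs_le. lra. }
  assert (HM : 0 <= M) by (eapply Rle_trans; [apply Rabs_pos | exact (Hu t Ht)]).
  destruct (MVT_cor2 u (fun t => psi (w t)) 0 1 Rlt_0_1) as [t1 [E1 Ht1]].
  { intros c Hc. now apply is_derive_Reals, Du. }
  assert (I1 : forall r, Rmin t1 t <= r <= Rmax t1 t -> 0 <= r <= 1).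
  { intros r Hr. assert (0 <= Rmin t1 t) by (apply Rmin_glb; lra).
    assert (Rmax t1 t <= 1) by (apply Rmax_lub; lra). lra. }
  destruct (last_point_below (fun t => H (w t)) t1 t C) as [s [Hs [HsC Hr]]].
  { intros r Hr. apply (continuity_pt_comp w H).
    - exact (is_derive_continuity_pt _ _ _ (Dw r (I1 r Hr))).
    - exact (is_derive_continuity_pt _ _ _ (DH (w r))). }
  { apply HC. replace (psi (w t1)) with (u 1 - u 0) by lra. apply Hdu; lra. }
  apply I1 in Hs.
  assert (PG : forall r, 0 < S0 * H (w r) + T0).
  { intros r. assert (A := Rmult_le_pos _ _ (Rlt_le _ _ HS) (PH (w r))). lra. }
  assert (Hne : forall r, Rmin s t < r < Rmax s t -> psi (w r) <> 0).
  { intros r Hr' E. apply (Rlt_not_le _ _ (Hr r Hr')). apply HC.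
    rewrite E, Rabs_R0. lra. }
  assert (V : ln (S0 * H (w t) + T0) - ln (S0 * H (w s) + T0) <= S0 * (2 * M)).
  { destruct (Rtotal_order s t) as [Hst|[Hst|Hst]].
    - rewrite Rmin_left, Rmax_right in Hne by lra.
      eapply Rle_trans; [apply Rle_abs|].
      eapply Rle_trans; [apply (log_energy_variation psi H u w q); try assumption|].
      + intros r Hr'. apply Du. lra.
      + intros r Hr'. apply Dw. lra.
      + intros r Hr'. apply Hq. lra.
      + apply Rmult_le_compat_l; [lra | now apply Hdu].
    - subst s. rewrite Rminus_diag. apply Rmult_le_pos; lra.
    - rewrite Rmin_right, Rmax_left in Hne by lra.
      eapply Rle_trans; [apply Rle_abs|]. rewrite Rabs_minus_sym.
      eapply Rle_trans; [apply (log_energy_variation psi H u w q); try assumption|].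
      + intros r Hr'. apply Du. lra.
      + intros r Hr'. apply Dw. lra.
      + intros r Hr'. apply Hq. lra.
      + apply Rmult_le_compat_l; [lra | now apply Hdu]. }
  rewrite <- (exp_ln (S0 * H (w t) + T0)) by apply PG.
  apply Rle_trans with (exp (ln (S0 * H (w s) + T0) + S0 * (2 * M))).
  - assert (V' : ln (S0 * H (w t) + T0) <= ln (S0 * H (w s) + T0) + S0 * (2 * M)) by lra.
    destruct V' as [V'|V']; [left; now apply exp_increasing | right; now rewrite V'].
  - rewrite exp_plus, exp_ln by apply PG.
    apply Rmult_le_compat_r; [apply Rlt_le, exp_pos|].
    apply Rplus_le_compat_r, Rmult_le_compat_l; lra.
Qed.

(** * Clamping *)

Definition clamp (a b x : R) : R := Rmax a (Rmin x b).

Lemma clamp_bounds (a b x : R) : a <= b -> a <= clamp a b x <= b.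
Proof.
  intros Hab. unfold clamp. split; [apply Rmax_l|].
  apply Rmax_lub; [exact Hab | apply Rmin_r].
Qed.

Lemma clamp_id (a b x : R) : a <= x <= b -> clamp a b x = x.
Proof.
  intros Hx. unfold clamp. rewrite Rmin_left, Rmax_right; lra.
Qed.

Lemma clamp_above (a b x : R) : a <= b <= x -> clamp a b x = b.
Proof.
  intros Hx. unfold clamp. rewrite Rmin_right, Rmax_right; lra.
Qed.

Lemma clamp_below (a b x : R) : x <= a <= b -> clamp a b x = a.
Proof.
  intros Hx. unfold clamp. rewrite Rmin_left, Rmax_left; lra.
Qed.

Lemma clamp_lipschitz (a b x y : R) : Rabs (clamp a b x - clamp a b y) <= Rabs (x - y).
Proof.
  unfold clamp.
  assert (A := Rle_abs (x - y)). assert (A' := Rle_abs (- (x - y))).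
  rewrite Rabs_Ropp in A'. apply Rabs_le.
  unfold Rmin. destruct (Rle_dec x b), (Rle_dec y b); unfold Rmax;
  repeat match goal with |- context [Rle_dec ?u ?v] => destruct (Rle_dec u v) end; lra.
Qed.

(** Clamping the time also extends [f], which is continuous only relative to [[0,1]], to a jointly
    continuous function on the whole space, as the Euler scheme requires. *)
Lemma continuous3_clamped (f : R -> R -> R -> R) (psi : R -> R) (a b c d : R) :
  continuous_on (fun p : R * R * R => unit_interval (fst (fst p)))
    (fun p => f (fst (fst p)) (snd (fst p)) (snd p)) ->
  (forall y, continuous psi y) ->
  continuous3 (fun t x y => f (clamp 0 1 t) (clamp a b x) (psi (clamp c d y))).
Proof.
  intros Cf Cpsi t x y eps Heps.
  specialize (Cf (clamp 0 1 t, clamp a b x, psi (clamp c d y)) (clamp_bounds 0 1 t Rle_0_1)).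
  destruct (Cf _ (locally_ball _ (mkposreal eps Heps))) as [[d1 Hd1] H1].
  destruct (Cpsi (clamp c d y) _ (locally_ball _ (mkposreal d1 Hd1))) as [[d2 Hd2] H2].
  exists (Rmin d1 d2). split; [now apply Rmin_pos|].
  assert (Hm1 := Rmin_l d1 d2). assert (Hm2 := Rmin_r d1 d2).
  intros t' x' y' Ht Hx Hy.
  apply (H1 (clamp 0 1 t', clamp a b x', psi (clamp c d y'))).
  - split; [split|].
    + change (Rabs (clamp 0 1 t' - clamp 0 1 t) < d1).
      eapply Rle_lt_trans; [apply clamp_lipschitz | lra].
    + change (Rabs (clamp a b x' - clamp a b x) < d1).
      eapply Rle_lt_trans; [apply clamp_lipschitz | lra].
    + change (Rabs (psi (clamp c d y') - psi (clamp c d y)) < d1).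
      apply H2. change (Rabs (clamp c d y' - clamp c d y) < d2).
      eapply Rle_lt_trans; [apply clamp_lipschitz | lra].
  - exact (clamp_bounds 0 1 t' Rle_0_1).
Qed.

(** * Primitives of increasing functions and the Legendre transform *)

Definition increasing_fun (psi : R -> R) : Prop := forall x y, x < y -> psi x < psi y.

Lemma increasing_fun_le (psi : R -> R) (x y : R) :
  increasing_fun psi -> x <= y -> psi x <= psi y.
Proof.
  intros Hpsi [H|H]; [now apply Rlt_le, Hpsi | right; now rewrite H].
Qed.

Lemma primitive_growth (psi H : R -> R) (a b : R) :
  increasing_fun psi -> (forall y, is_derive H y (psi y)) ->
  a <= b -> psi a * (b - a) <= H b - H a.
Proof.
  intros Hpsi DH [Hab|<-]; [|lra].
  destruct (MVT_cor2 H psi a b Hab) as [c [E Hc]].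
  { intros c _. now apply is_derive_Reals. }
  rewrite E. apply Rmult_le_compat_r; [lra|].
  apply increasing_fun_le; [exact Hpsi | lra].
Qed.

Lemma primitive_mono (psi H : R -> R) (a b : R) :
  increasing_fun psi -> psi 0 = 0 -> (forall y, is_derive H y (psi y)) ->
  0 <= a <= b -> H a <= H b.
Proof.
  intros Hpsi H0 DH Hab.
  assert (G := primitive_growth psi H a b Hpsi DH ltac:(lra)).
  assert (P : 0 <= psi a) by (rewrite <- H0; apply increasing_fun_le; [exact Hpsi | lra]).
  assert (0 <= psi a * (b - a)) by (apply Rmult_le_pos; lra). lra.
Qed.

Lemma increasing_fun_reflect (psi : R -> R) :
  increasing_fun psi -> increasing_fun (fun y => - psi (- y)).
Proof.
  intros Hpsi x y Hxy. apply Ropp_lt_contravar, Hpsi. lra.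
Qed.

Lemma is_derive_reflect (H : R -> R) (y l : R) :
  is_derive H (- y) l -> is_derive (fun y => H (- y)) y (- l).
Proof.
  intros D. evar_last.
  - apply (is_derive_comp H Ropp); [exact D|].
    apply (is_derive_opp (fun y : R => y)), is_derive_id.
  - unfold scal, opp, one; simpl. unfold mult; simpl. ring.
Qed.

Lemma primitive_mono_neg (psi H : R -> R) (a b : R) :
  increasing_fun psi -> psi 0 = 0 -> (forall y, is_derive H y (psi y)) ->
  b <= a <= 0 -> H a <= H b.
Proof.
  intros Hpsi H0 DH Hab.
  generalize (primitive_mono (fun y => - psi (- y)) (fun y => H (- y)) (- a) (- b)).
  rewrite !Ropp_involutive. intros G. apply G.
  - now apply increasing_fun_reflect.
  - now rewrite Ropp_0, H0, Ropp_0.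
  - intros y. now apply is_derive_reflect.
  - lra.
Qed.

Lemma primitive_nonneg (psi H : R -> R) (y : R) :
  increasing_fun psi -> psi 0 = 0 -> (forall y, is_derive H y (psi y)) -> H 0 = 0 ->
  0 <= H y.
Proof.
  intros Hpsi H0 DH HH. rewrite <- HH.
  destruct (Rle_lt_dec 0 y).
  - apply (primitive_mono psi); try assumption. lra.
  - apply (primitive_mono_neg psi); try assumption. lra.
Qed.

(** A symmetric clamp moves its argument toward 0, the minimum of [H]. A growth bound in the clamped
    [w] therefore implies the same bound in [w], the form that [energy_bound] needs. *)
Lemma primitive_clamp_le (psi H : R -> R) (W y : R) :
  increasing_fun psi -> psi 0 = 0 -> (forall y, is_derive H y (psi y)) ->
  0 <= W -> H (clamp (- W) W y) <= H y.
Proof.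
  intros Hpsi H0 DH HW.
  destruct (Rle_lt_dec W y); [|destruct (Rle_lt_dec y (- W))].
  - rewrite clamp_above by lra. apply (primitive_mono psi); try assumption. lra.
  - rewrite clamp_below by lra. apply (primitive_mono_neg psi); try assumption. lra.
  - rewrite clamp_id by lra. lra.
Qed.

Lemma primitive_le_on_interval (psi H : R -> R) (a b y : R) :
  increasing_fun psi -> psi 0 = 0 -> (forall y, is_derive H y (psi y)) -> H 0 = 0 ->
  a <= y <= b -> H y <= H a + H b.
Proof.
  intros Hpsi H0 DH HH Hy.
  assert (Pa := primitive_nonneg psi H a Hpsi H0 DH HH).
  assert (Pb := primitive_nonneg psi H b Hpsi H0 DH HH).
  destruct (Rle_lt_dec 0 y).
  - assert (H y <= H b) by (apply (primitive_mono psi); try assumption; lra). lra.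
  - assert (H y <= H a) by (apply (primitive_mono_neg psi); try assumption; lra). lra.
Qed.

(** Beyond 1 the primitive grows at least with the slope [psi 1 > 0]. *)
Lemma primitive_coercive_pos (psi H : R -> R) (C y : R) :
  increasing_fun psi -> psi 0 = 0 -> (forall y, is_derive H y (psi y)) -> H 0 = 0 ->
  0 <= C -> H y <= C -> y <= 1 + C / psi 1.
Proof.
  intros Hpsi H0 DH HH HC Hy.
  assert (P : 0 < psi 1) by (rewrite <- H0; apply Hpsi; lra).
  assert (Q : 0 <= C / psi 1) by (apply Rdiv_le_0_compat; lra).
  destruct (Rle_lt_dec y 1); [lra|].
  assert (G := primitive_growth psi H 1 y Hpsi DH ltac:(lra)).
  assert (N := primitive_nonneg psi H 1 Hpsi H0 DH HH).
  apply (Rmult_le_reg_l (psi 1)); [exact P|].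
  replace (psi 1 * (1 + C / psi 1)) with (psi 1 + C) by (field; lra). lra.
Qed.

Lemma primitive_coercive (psi H : R -> R) (C : R) :
  increasing_fun psi -> psi 0 = 0 -> (forall y, is_derive H y (psi y)) -> H 0 = 0 ->
  0 <= C -> exists W, 0 <= W /\ forall y, H y <= C -> - W <= y <= W.
Proof.
  intros Hpsi H0 DH HH HC.
  assert (P1 : 0 < psi 1) by (rewrite <- H0; apply Hpsi; lra).
  assert (P2 : 0 < - psi (- (1))) by (assert (psi (- (1)) < psi 0) by (apply Hpsi; lra); lra).
  assert (Q1 : 0 <= C / psi 1) by (apply Rdiv_le_0_compat; lra).
  assert (Q2 : 0 <= C / - psi (- (1))) by (apply Rdiv_le_0_compat; lra).
  exists (1 + C / psi 1 + C / - psi (- (1))). split; [lra|]. intros y Hy.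
  assert (A1 := primitive_coercive_pos psi H C y Hpsi H0 DH HH HC Hy).
  assert (A2 : - y <= 1 + C / - psi (- (1))).
  { apply (primitive_coercive_pos (fun y => - psi (- y)) (fun y => H (- y))).
    - now apply increasing_fun_reflect.
    - now rewrite Ropp_0, H0, Ropp_0.
    - intros z. now apply is_derive_reflect.
    - now rewrite Ropp_0.
    - exact HC.
    - now rewrite Ropp_involutive. }
  lra.
Qed.

Lemma strictly_convex_above_tangent (Phi : R -> R) (x y : R) :
  strictly_convex Phi -> ex_derive Phi x -> Derive Phi x * (y - x) <= Phi y - Phi x.
Proof.
  intros Hc Hd. destruct (Req_dec x y) as [->|Hne]; [lra|].
  apply Rnot_lt_le. intros Hlt.
  (* [z] is [Phi] along the segment minus the linear part of the chord. If the inequality failed,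
     [z] would increase at 0 and [Phi] would rise above its chord. *)
  pose (z s := Phi (x + s * (y - x)) - s * (Phi y - Phi x)).
  assert (Dz : is_derive z 0 (Derive Phi x * (y - x) - (Phi y - Phi x))).
  { unfold z. apply (is_derive_minus (fun s => Phi (x + s * (y - x))) (fun s => s * (Phi y - Phi x))).
    - evar_last.
      + apply (is_derive_comp Phi (fun s => x + s * (y - x))).
        * rewrite Rmult_0_l, Rplus_0_r. now apply Derive_correct.
        * auto_derive; [exact I | reflexivity].
      + unfold scal; simpl. unfold mult; simpl. ring.
    - auto_derive; [exact I | ring]. }
  destruct (is_derive_pos_increasing_at z 0 _ Dz ltac:(lra)) as [d [Hd0 Hinc]].
  set (k := Rmin (d / 2) (1 / 2)).
  assert (Hk1 : k <= d / 2) by apply Rmin_l.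
  assert (Hk2 : k <= 1 / 2) by apply Rmin_r.
  assert (Hk0 : 0 < k) by (apply Rmin_pos; lra).
  destruct (Hinc k ltac:(lra)) as [_ A].
  assert (B := Hc x y k Hne ltac:(lra)).
  unfold z in A. rewrite Rplus_0_l, Rmult_0_l, Rmult_0_l, Rplus_0_r, Rminus_0_r in A.
  replace ((1 - k) * x + k * y) with (x + k * (y - x)) in B by ring. nra.
Qed.

(** Adding the tangent inequalities at [psi x] and [psi y] gives [0 <= (x - y) * (psi x - psi y)];
    equal values are excluded because [Derive Phi] is a left inverse of [psi]. *)
Lemma derive_inverse_increasing (Phi psi : R -> R) :
  strictly_convex Phi -> (forall x, ex_derive Phi x) ->
  (forall y, Derive Phi (psi y) = y) -> increasing_fun psi.
Proof.
  intros Hc Hd Hinv x y Hxy. apply Rnot_le_lt. intros Hle.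
  assert (A := strictly_convex_above_tangent Phi (psi x) (psi y) Hc (Hd _)).
  assert (B := strictly_convex_above_tangent Phi (psi y) (psi x) Hc (Hd _)).
  rewrite Hinv in A, B.
  destruct Hle as [Hlt|E].
  - nra.
  - rewrite <- (Hinv x), <- (Hinv y), E in Hxy. lra.
Qed.

(* At [y = Derive Phi v] the function differentiated here is the quantity
   [Derive Phi v * v - Phi v] of the growth condition. *)
Lemma legendre_derive (Phi psi : R -> R) (y : R) :
  (forall x, ex_derive Phi x) -> ex_derive psi y -> Derive Phi (psi y) = y ->
  is_derive (fun y => y * psi y - Phi (psi y)) y (psi y).
Proof.
  intros Hd Hpsi Hinv. apply Derive_correct in Hpsi.
  evar_last.
  - apply (is_derive_minus (fun y => y * psi y) (fun y => Phi (psi y))).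
    + apply (is_derive_mult (fun y => y) psi); [apply is_derive_id | exact Hpsi | intros; apply Rmult_comm].
    + apply (is_derive_comp Phi psi); [apply Derive_correct, Hd | exact Hpsi].
  - rewrite Hinv. unfold minus, plus, opp, scal, one, mult; simpl. unfold mult; simpl. ring.
Qed.

(** * Boundary value problem for the planar system *)

Lemma euler_deviation (p q : R -> R -> R -> R) (K x0 y0 : R) (n i : nat) :
  (forall t x y, Rabs (q t x y) <= K) -> (i <= S n)%nat ->
  Rabs (snd (euler p q (/ INR (S n)) x0 y0 i) - y0) <= K.
Proof.
  intros Bq Hi.
  assert (Hn : 0 < INR (S n)) by (apply lt_0_INR; lia).
  assert (Hh : 0 < / INR (S n)) by now apply Rinv_0_lt_compat.
  assert (HK : 0 <= K) by (eapply Rle_trans; [apply Rabs_pos | apply (Bq 0 0 0)]).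
  assert (G := increment_bound_le (fun i => snd (euler p q (/ INR (S n)) x0 y0 i))
    (/ INR (S n)) K 0 i).
  cbn [euler snd] in G. simpl (INR 0) in G. rewrite Rminus_0_r in G.
  eapply Rle_trans; [apply G; [|lia]|].
  - intros k.
    match goal with |- Rabs (?a + ?b - ?a) <= _ => replace (a + b - a) with b by ring end.
    rewrite Rabs_mult, Rabs_pos_eq by lra. apply Rmult_le_compat_l; [lra | apply Bq].
  - rewrite <- (Rmult_1_l K) at 2. apply Rmult_le_compat_r; [exact HK|].
    apply (Rmult_le_reg_r (INR (S n))); [exact Hn|].
    rewrite Rmult_assoc, Rinv_l, Rmult_1_r, Rmult_1_l by lra. now apply le_INR.
Qed.

Lemma deviation_bound (y q : R -> R) (K : R) :
  (forall t, 0 <= t -> is_derive y t (q t)) -> (forall t, Rabs (q t) <= K) ->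
  forall t, 0 <= t <= 1 -> Rabs (y t - y 0) <= K.
Proof.
  intros Dy Bq t Ht.
  assert (HK : 0 <= K) by (eapply Rle_trans; [apply Rabs_pos | apply (Bq 0)]).
  destruct (proj1 Ht) as [Hlt|<-]; [|rewrite Rminus_diag, Rabs_R0; exact HK].
  destruct (MVT_cor2 y q 0 t Hlt) as [c [E Hc]].
  { intros c Hc. apply is_derive_Reals, Dy. lra. }
  rewrite E, Rabs_mult, Rminus_0_r, (Rabs_pos_eq t) by lra.
  assert (A := Bq c). assert (A' := Rabs_pos (q c)). nra.
Qed.

(** Keeps just what the endpoint estimates use: of the dynamics of [Y] only the deviation bound
    survives, and [X] advances with the unclamped [psi]. *)
Definition euler_polygon (psi : R -> R) (K x0 y0 : R) (N : nat) (X Y : nat -> R) : Prop :=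
  X O = x0 /\ (forall i, (i <= N)%nat -> Rabs (Y i - y0) <= K) /\
  (forall i, (i < N)%nat -> X (S i) = X i + / INR N * psi (Y i)).

(** Common form of both boundary conditions. The four implications on [u0] and [g] exclude an
    extremum of [u] beyond [M] at an endpoint. Shooting values are demanded for every [K], because
    the relevant [K], a bound of the clamped [f], is fixed only inside the proof. *)
Lemma bvp_exists (psi phi H u0 : R -> R) (f : R -> R -> R -> R) (g : R -> R -> R)
    (r M S0 T0 : R) :
  increasing_fun psi -> (forall v, psi (phi v) = v) -> psi 0 = 0 ->
  (forall y, continuous psi y) ->
  (forall y, is_derive H y (psi y)) -> H 0 = 0 ->
  continuous_on (fun p : R * R * R => unit_interval (fst (fst p)))
    (fun p => f (fst (fst p)) (snd (fst p)) (snd p)) ->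
  0 < r < M ->
  (forall t x, unit_interval t -> r < Rabs x -> 0 < x * f t x 0) ->
  0 < S0 -> 0 < T0 ->
  (forall t x y, unit_interval t -> Rabs x <= M -> Rabs (f t x (psi y)) <= S0 * H y + T0) ->
  (forall s, continuous u0 s) ->
  (forall z : R * R, continuous (fun z => g (fst z) (snd z)) z) ->
  (forall s, M < u0 s -> 0 < s) -> (forall s, u0 s < - M -> s < 0) ->
  (forall x y, g x y = 0 -> M < x -> y < 0) -> (forall x y, g x y = 0 -> x < - M -> 0 < y) ->
  (forall K, 0 <= K -> exists s1 s2, s1 <= s2 /\
    forall N X Y, (0 < N)%nat ->
      (euler_polygon psi K (u0 s1) s1 N X Y -> g (X N) (Y N) <= 0) /\
      (euler_polygon psi K (u0 s2) s2 N X Y -> 0 <= g (X N) (Y N))) ->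
  exists u w : R -> R,
    u 0 = u0 (w 0) /\ g (u 1) (w 1) = 0 /\
    (forall t, unit_interval t -> is_derive u t (psi (w t))) /\
    (forall t, unit_interval t -> is_derive w t (f t (u t) (psi (w t)))).
Proof.
  intros Hinc Hphi psi0 Cpsi DH H0 Cf HrM Hsign HS HT Hgrow Cu Cg Hl1 Hl2 Hr1 Hr2 Hshoot.
  assert (PH : forall y, 0 <= H y) by (intros y; now apply (primitive_nonneg psi)).
  assert (Hpos : forall y, 0 < y -> 0 < psi y) by (intros y Hy; rewrite <- psi0; now apply Hinc).
  assert (Hneg : forall y, y < 0 -> psi y < 0) by (intros y Hy; rewrite <- psi0; now apply Hinc).
  assert (Hzero : forall y, psi y = 0 -> y = 0).
  { intros y Hy. destruct (Rtotal_order y 0) as [G|[G|G]]; [|exact G|].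
    - specialize (Hneg y G). lra.
    - specialize (Hpos y G). lra. }
  (* A slope of size at most [2 * M] puts [y] between [phi (- (2 * M))] and [phi (2 * M)]. *)
  set (C := H (phi (- (2 * M))) + H (phi (2 * M))).
  assert (HC0 : 0 <= C) by (assert (A := PH (phi (- (2 * M)))); assert (A' := PH (phi (2 * M))); unfold C; lra).
  assert (HC : forall y, Rabs (psi y) <= 2 * M -> H y <= C).
  { intros y Hy. apply Rabs_le_between in Hy.
    apply (primitive_le_on_interval psi); try assumption. split.
    - apply Rnot_lt_le. intros Hlt. apply Hinc in Hlt. rewrite Hphi in Hlt. lra.
    - apply Rnot_lt_le. intros Hlt. apply Hinc in Hlt. rewrite Hphi in Hlt. lra. }
  (* The bound on [H (w t)] that [energy_bound] will give. It refers to no clamp, so [W] can be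
     fixed before the clamped system is formed. *)
  set (E := (S0 * C + T0) * exp (S0 * (2 * M)) / S0).
  assert (HE : 0 <= E).
  { unfold E. apply Rdiv_le_0_compat; [|exact HS]. apply Rmult_le_pos; [|apply Rlt_le, exp_pos].
    assert (0 <= S0 * C) by (apply Rmult_le_pos; lra). lra. }
  destruct (primitive_coercive psi H E Hinc psi0 DH H0 HE) as [W [HW Hcoer]].
  pose (q t x y := f (clamp 0 1 t) (clamp (- M) M x) (psi (clamp (- W) W y))).
  assert (Cq : continuous3 q) by now apply continuous3_clamped.
  assert (Gq : forall t x y, Rabs (q t x y) <= S0 * H (clamp (- W) W y) + T0).
  { intros t x y. apply Hgrow.
    - exact (clamp_bounds 0 1 t Rle_0_1).
    - apply Rabs_le, clamp_bounds. lra. }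
  set (K := S0 * (H (- W) + H W) + T0).
  assert (Bq : forall t x y, Rabs (q t x y) <= K).
  { intros t x y. eapply Rle_trans; [apply Gq|]. unfold K.
    apply Rplus_le_compat_r, Rmult_le_compat_l; [lra|].
    apply (primitive_le_on_interval psi); try assumption. apply clamp_bounds. lra. }
  assert (HK : 0 <= K) by (eapply Rle_trans; [apply Rabs_pos | apply (Bq 0 0 0)]).
  destruct (Hshoot K HK) as [s1 [s2 [Hs Hends]]].
  (* Started in [[s1, s2]], [w] moves by at most [K] in unit time and stays within [W2], so this
     clamp bounds [p] without altering [psi] along any trajectory considered. *)
  set (W2 := Rabs s1 + Rabs s2 + K).
  assert (As1 := Rabs_pos s1). assert (As2 := Rabs_pos s2).
  assert (Bs1 := Rle_abs s1). assert (Bs2 := Rle_abs s2).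
  assert (Bs1' := Rle_abs (- s1)). assert (Bs2' := Rle_abs (- s2)).
  rewrite Rabs_Ropp in Bs1', Bs2'.
  assert (HW2 : forall s y, s1 <= s <= s2 -> Rabs (y - s) <= K -> clamp (- W2) W2 y = y).
  { intros s y Hss Hy. apply Rabs_le_between in Hy. apply clamp_id. unfold W2. lra. }
  pose (p (t x y : R) := psi (clamp (- W2) W2 y)).
  assert (Cp : continuous3 p).
  { apply (continuous3_clamped (fun _ _ v => v) psi 0 0 (- W2) W2); [|exact Cpsi].
    intros z Hz. eapply filterlim_filter_le_1; [apply filter_le_within|].
    apply (continuous_snd (U := prod_UniformSpace R_UniformSpace R_UniformSpace) (V := R_UniformSpace)). }
  assert (Bp : forall t x y, Rabs (p t x y) <= Rabs (psi (- W2)) + Rabs (psi W2)).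
  { intros t x y. unfold p.
    assert (G := clamp_bounds (- W2) W2 y ltac:(unfold W2; lra)).
    assert (G1 := increasing_fun_le psi _ _ Hinc (proj1 G)).
    assert (G2 := increasing_fun_le psi _ _ Hinc (proj2 G)).
    assert (A1 := Rle_abs (- psi (- W2))). rewrite Rabs_Ropp in A1.
    assert (A2 := Rle_abs (psi W2)).
    assert (A3 := Rabs_pos (psi (- W2))). assert (A4 := Rabs_pos (psi W2)).
    apply Rabs_le. lra. }
  set (K2 := Rabs (psi (- W2)) + Rabs (psi W2)) in Bp.
  assert (HP : forall s n, s1 <= s <= s2 ->
    euler_polygon psi K (u0 s) s (S n)
      (fun i => fst (euler p q (/ INR (S n)) (u0 s) s i))
      (fun i => snd (euler p q (/ INR (S n)) (u0 s) s i))).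
  { intros s n Hss. split; [reflexivity|]. split.
    - intros i Hi. now apply euler_deviation.
    - intros i Hi. cbn [euler fst snd]. unfold p at 2.
      rewrite (HW2 s); [reflexivity | exact Hss |].
      apply euler_deviation; [exact Bq | lia]. }
  destruct (shooting p q (K + K2) u0 g s1 s2 Cp Cq) as [s [x [y [Hss [Hx0 [Hy0 [Hg [Dx Dy]]]]]]]];
    try assumption.
  { intros t x y. specialize (Bp t x y). lra. }
  { intros t x y. specialize (Bq t x y). assert (A := Bp t x y).
    assert (A' := Rabs_pos (p t x y)). lra. }
  { intros n. apply (proj1 (Hends (S n) (fun i => fst (euler p q (/ INR (S n)) (u0 s1) s1 i))
      (fun i => snd (euler p q (/ INR (S n)) (u0 s1) s1 i)) ltac:(lia))).
    apply HP. lra. }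
  { intros n. apply (proj2 (Hends (S n) (fun i => fst (euler p q (/ INR (S n)) (u0 s2) s2 i))
      (fun i => snd (euler p q (/ INR (S n)) (u0 s2) s2 i)) ltac:(lia))).
    apply HP. lra. }
  assert (Dx' : forall t, 0 <= t <= 1 -> is_derive x t (psi (y t))).
  { intros t Ht. specialize (Dx t ltac:(lra)). unfold p in Dx.
    rewrite (HW2 s) in Dx; [exact Dx | exact Hss |].
    rewrite <- Hy0. now apply (deviation_bound y (fun t => q t (x t) (y t))). }
  assert (Dy' : forall t, 0 <= t <= 1 -> is_derive y t (q t (x t) (y t))).
  { intros t Ht. apply Dy. lra. }
  assert (Hq0 : forall t z, q t z 0 = f (clamp 0 1 t) (clamp (- M) M z) 0).
  { intros t z. unfold q. rewrite (clamp_id (- W) W 0) by lra. now rewrite psi0. }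
  (* Where [x] exceeds [M] and [y] vanishes, the clamped [f] takes the value of [f] at [M] with zero
     velocity, which is positive because [r < M]. *)
  assert (Hup : forall t, 0 <= t <= 1 -> x t <= M).
  { apply (maximum_principle psi x y (fun t => q t (x t) (y t))); try assumption.
    - intros t Ht Hlt Ey. rewrite Ey, Hq0, (clamp_above (- M) M) by lra.
      assert (G := Hsign (clamp 0 1 t) M (clamp_bounds 0 1 t Rle_0_1)).
      rewrite Rabs_pos_eq in G by lra. specialize (G ltac:(lra)). nra.
    - intros Hlt. apply Hpos. rewrite Hy0. apply Hl1. now rewrite <- Hx0.
    - intros Hlt. apply Hneg. now apply (Hr1 (x 1)). }
  assert (Hlow : forall t, 0 <= t <= 1 -> - x t <= M).
  { apply (maximum_principle (fun z => - psi (- z)) (fun t => - x t) (fun t => - y t)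
      (fun t => - q t (x t) (y t))).
    - intros z Hz. assert (A := Hneg (- z) ltac:(lra)). lra.
    - intros z Hz. assert (A := Hzero (- z) ltac:(lra)). lra.
    - intros t Ht. rewrite Ropp_involutive. now apply (is_derive_opp x), Dx'.
    - intros t Ht. now apply (is_derive_opp y), Dy'.
    - intros t Ht Hlt Ey. assert (Ey' : y t = 0) by lra.
      rewrite Ey', Hq0, (clamp_below (- M) M) by lra.
      assert (G := Hsign (clamp 0 1 t) (- M) (clamp_bounds 0 1 t Rle_0_1)).
      rewrite Rabs_Ropp, Rabs_pos_eq in G by lra. specialize (G ltac:(lra)). nra.
    - intros Hlt. rewrite Ropp_involutive.
      enough (psi (y 0) < 0) by lra. apply Hneg. rewrite Hy0. apply Hl2. rewrite <- Hx0. lra.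
    - intros Hlt. rewrite Ropp_involutive.
      enough (0 < psi (y 1)) by lra. apply Hpos. apply (Hr2 (x 1)); [exact Hg | lra]. }
  assert (HxM : forall t, 0 <= t <= 1 -> - M <= x t <= M).
  { intros t Ht. assert (A := Hup t Ht). assert (A' := Hlow t Ht). lra. }
  assert (HyW : forall t, 0 <= t <= 1 -> - W <= y t <= W).
  { intros t Ht. apply Hcoer.
    assert (G := energy_bound psi H x y (fun t => q t (x t) (y t)) S0 T0 M C HS HT DH PH HC
      (fun t Ht => Rabs_le _ _ (HxM t Ht)) Dx' Dy').
    assert (G' : S0 * H (y t) + T0 <= (S0 * C + T0) * exp (S0 * (2 * M))).
    { apply G; [|exact Ht]. intros t' Ht'. eapply Rle_trans; [apply Gq|].
      apply Rplus_le_compat_r, Rmult_le_compat_l; [lra|].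
      now apply (primitive_clamp_le psi). }
    apply (Rmult_le_reg_l S0); [exact HS|].
    replace (S0 * E) with ((S0 * C + T0) * exp (S0 * (2 * M))) by (unfold E; field; lra). lra. }
  exists x, y. split; [now rewrite Hy0|]. split; [exact Hg|]. split; [exact Dx'|].
  intros t Ht. specialize (Dy' t Ht). unfold q in Dy'.
  rewrite (clamp_id 0 1) in Dy' by exact Ht.
  rewrite (clamp_id (- M) M) in Dy' by now apply HxM.
  rewrite (clamp_id (- W) W) in Dy' by now apply HyW. exact Dy'.
Qed.

(** * Return to the original equation and the two boundary conditions *)

Lemma is_derive_D_in_unit_interval (u du : R -> R) (t : R) :
  is_derive u t (du t) -> D_in u du unit_interval t.
Proof.
  intros D. apply (D_in_imp _ _ no_cond); [intros; exact I|].
  apply derivable_pt_lim_D_in. now apply is_derive_Reals.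
Qed.

Lemma first_order_system_solution (Phi psi : R -> R) (f : R -> R -> R -> R)
    (BC : (R -> R) -> (R -> R) -> Prop) (u w : R -> R) :
  (forall y, Derive Phi (psi y) = y) -> (forall y, continuous psi y) ->
  continuous_on (fun p : R * R * R => unit_interval (fst (fst p)))
    (fun p => f (fst (fst p)) (snd (fst p)) (snd p)) ->
  (forall t, unit_interval t -> is_derive u t (psi (w t))) ->
  (forall t, unit_interval t -> is_derive w t (f t (u t) (psi (w t)))) ->
  BC u (fun t => psi (w t)) ->
  is_solution Phi f BC u.
Proof.
  intros Hinv Cpsi Cf Du Dw HBC.
  assert (Cdu : forall t, unit_interval t -> continuous (fun t => psi (w t)) t).
  { intros t Ht. apply (continuous_comp w psi); [|apply Cpsi].
    apply (ex_derive_continuous w). eexists. now apply Dw. }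
  exists (fun t => psi (w t)), (fun t => f t (u t) (psi (w t))).
  split; [split | split; [exact HBC | split; [split|]]].
  - intros t Ht. apply is_derive_D_in_unit_interval. now apply Du.
  - intros t Ht. eapply filterlim_filter_le_1; [apply filter_le_within | now apply Cdu].
  - intros t Ht. apply is_derive_D_in_unit_interval.
    apply (is_derive_ext w); [intros s; now rewrite Hinv | now apply Dw].
  - intros t Ht.
    refine (filterlim_comp _ _ _ (fun t => (t, u t, psi (w t)))
      (fun p => f (fst (fst p)) (snd (fst p)) (snd p)) _ _ _ _ (Cf (t, u t, psi (w t)) Ht)).
    intros P [eps HP].
    assert (Cu : continuous u t) by (apply (ex_derive_continuous u); eexists; now apply Du).
    pose proof (Cu _ (locally_ball _ eps)) as B1.
    pose proof (Cdu t Ht _ (locally_ball _ eps)) as B2.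
    pose proof (locally_ball t eps) as B0.
    unfold filtermap, within in *.
    generalize (filter_and _ _ B0 (filter_and _ _ B1 B2)). apply filter_imp.
    intros s [G0 [G1 G2]] Hs. apply HP; [|exact Hs]. split; [split|]; assumption.
  - reflexivity.
Qed.

Lemma bounded_on_strip (g : R * R -> R) (M : R) :
  bounded_on_bounded_sets (fun p : R * R => unit_interval (fst p)) g ->
  exists K, 0 < K /\ forall t x, unit_interval t -> Rabs x <= M -> g (t, x) <= K.
Proof.
  intros Hg.
  destruct (Hg (fun p => unit_interval (fst p) /\ Rabs (snd p) <= M)) as [K HK].
  - now intros p [Hp _].
  (* The norm on [R * R] is Euclidean. *)
  - exists (sqrt (1 + M * M)). intros [t x] [Ht Hx]. simpl in Ht, Hx. destruct Ht as [Ht0 Ht1].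
    change (sqrt (Rabs t ^ 2 + Rabs x ^ 2) <= sqrt (1 + M * M)).
    apply sqrt_le_1_alt.
    assert (A := Rabs_pos x). assert (A' := Rabs_pos_eq t Ht0). rewrite A'. nra.
  - exists (Rabs K + 1). assert (A := Rabs_pos K). split; [lra|]. intros t x Ht Hx.
    specialize (HK (t, x) (conj Ht Hx)).
    assert (A1 := Rle_abs (g (t, x))). assert (A2 := Rle_abs K). lra.
Qed.

Lemma polygon_final_lower_bound (psi : R -> R) (K x0 y0 c : R) (N : nat) (X Y : nat -> R) :
  euler_polygon psi K x0 y0 N X Y -> (0 < N)%nat ->
  (forall y, Rabs (y - y0) <= K -> c <= psi y) -> x0 + c <= X N.
Proof.
  intros [HX0 [HY HX]] HN Hc.
  assert (HN' : 0 < INR N) by now apply lt_0_INR.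
  assert (G : forall i, (i <= N)%nat -> x0 + INR i * / INR N * c <= X i).
  { induction i as [|i IH]; intros Hi.
    - rewrite HX0. simpl. lra.
    - rewrite HX, S_INR by lia. specialize (IH ltac:(lia)).
      assert (A := Hc _ (HY i ltac:(lia))).
      assert (/ INR N * c <= / INR N * psi (Y i))
        by (apply Rmult_le_compat_l; [apply Rlt_le, Rinv_0_lt_compat | ]; assumption).
      lra. }
  specialize (G N (le_n N)). rewrite Rinv_r in G by lra. lra.
Qed.

Lemma polygon_final_upper_bound (psi : R -> R) (K x0 y0 c : R) (N : nat) (X Y : nat -> R) :
  euler_polygon psi K x0 y0 N X Y -> (0 < N)%nat ->
  (forall y, Rabs (y - y0) <= K -> psi y <= c) -> X N <= x0 + c.
Proof.
  intros [HX0 [HY HX]] HN Hc.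
  enough (- x0 + - c <= - X N) by lra.
  apply (polygon_final_lower_bound (fun y => - psi y) K (- x0) y0 (- c) N (fun i => - X i) Y).
  - split; [now rewrite HX0|]. split; [exact HY|]. intros i Hi. rewrite HX by exact Hi. ring.
  - exact HN.
  - intros y Hy. specialize (Hc y Hy). lra.
Qed.

Theorem mainTheorem1
  (Phi : R -> R) (f : R -> R -> R -> R)
  (Phi_strictly_convex : strictly_convex Phi)
  (Phi_differentiable : forall x : R, ex_derive Phi x)
  (Phi_superlinear_p : is_lim (fun x => Phi x / Rabs x) p_infty p_infty)
  (Phi_superlinear_m : is_lim (fun x => Phi x / Rabs x) m_infty p_infty)
  (Phi_0 : Phi 0 = 0)
  (dPhi_0 : Derive Phi 0 = 0)
  (dPhi_inv_C1 : exists psi : R -> R,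
     is_inverse_fun psi (Derive Phi) /\ continuously_differentiable psi)
  (Phi_growth : exists k : R, 1 < k /\ forall x, k * Phi x <= Derive Phi x * x)
  (f_continuous :
     continuous_on (fun p : R * R * R => unit_interval (fst (fst p)))
       (fun p => f (fst (fst p)) (snd (fst p)) (snd p)))
  (f_sign : exists r : R, 0 < r /\
     forall t x, unit_interval t -> r < Rabs x -> 0 < x * f t x 0)
  (f_growth : exists S T : R -> R -> R,
     (forall t x, unit_interval t -> 0 < S t x /\ 0 < T t x) /\
     bounded_on_bounded_sets (fun p : R * R => unit_interval (fst p))
       (fun p => S (fst p) (snd p)) /\
     bounded_on_bounded_sets (fun p : R * R => unit_interval (fst p))
       (fun p => T (fst p) (snd p)) /\
     (forall t x v, unit_interval t ->
        Rabs (f t x v) <= S t x * (Derive Phi v * v - Phi v) + T t x)) :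
  (forall A B : R, exists u : R -> R, is_solution Phi f (dirichlet A B) u) /\
  (forall alpha beta a b A B : R,
     0 < alpha -> 0 < beta -> 0 < a -> 0 < b ->
     exists u : R -> R,
       is_solution Phi f (sturm_liouville alpha beta a b A B) u).
Proof.
  destruct dPhi_inv_C1 as [psi [[Hpsiphi Hphipsi] [Dpsi _]]].
  destruct f_sign as [r [Hr Hsign]].
  destruct f_growth as [S [T [HST [BS [BT Hgrow]]]]].
  assert (Hinc := derive_inverse_increasing Phi psi Phi_strictly_convex Phi_differentiable Hphipsi).
  assert (Hle : forall x y, x <= y -> psi x <= psi y)
    by (intros x y; now apply increasing_fun_le).
  assert (psi0 := Hpsiphi 0). rewrite dPhi_0 in psi0.
  assert (Cpsi : forall y, continuous psi y) by (intros y; apply (ex_derive_continuous psi), Dpsi).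
  pose (H y := y * psi y - Phi (psi y)).
  assert (DH : forall y, is_derive H y (psi y)) by (intros y; now apply legendre_derive).
  assert (H0 : H 0 = 0) by (unfold H; rewrite psi0, Phi_0; ring).
  assert (Hgrow' : forall M, exists S0 T0, 0 < S0 /\ 0 < T0 /\
    forall t x y, unit_interval t -> Rabs x <= M -> Rabs (f t x (psi y)) <= S0 * H y + T0).
  { intros M. destruct (bounded_on_strip _ M BS) as [S0 [HS0 HS]].
    destruct (bounded_on_strip _ M BT) as [T0 [HT0 HT]].
    exists S0, T0. split; [exact HS0|]. split; [exact HT0|]. intros t x y Ht Hx.
    eapply Rle_trans; [now apply Hgrow|]. rewrite Hphipsi.
    apply Rplus_le_compat; [|now apply HT].
    apply Rmult_le_compat_r; [|now apply HS].
    now apply (primitive_nonneg psi H y). }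
  split.
  - intros A B.
    assert (PA := Rabs_pos A). assert (PB := Rabs_pos B).
    assert (LA := Rle_abs A). assert (LB := Rle_abs B).
    assert (NA := Rle_abs (- A)). assert (NB := Rle_abs (- B)). rewrite Rabs_Ropp in NA, NB.
    (* With [Rabs A] and [Rabs B] below this bound no boundary value lies beyond it, and the
       endpoint implications hold vacuously. *)
    destruct (Hgrow' (r + 1 + Rabs A + Rabs B)) as [S0 [T0 [HS0 [HT0 HG]]]].
    destruct (bvp_exists psi (Derive Phi) H (fun _ => A) f (fun x _ => x - B) r
      (r + 1 + Rabs A + Rabs B) S0 T0) as [u [w [E0 [E1 [Du Dw]]]]];
      try assumption; try (intros; lra).
    + intros s. apply continuous_const.
    + intros z. apply (continuous_minus (fun z : R * R => fst z) (fun _ => B)).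
      * apply continuous_fst.
      * apply continuous_const.
    (* [B - A] is the slope of the straight line joining the boundary values. A shift of [w 0] by
       [K] outweighs the deviation of [w], so all slopes of the polygon lie on one side of it. *)
    + intros K HK. exists (Derive Phi (B - A) - K), (Derive Phi (B - A) + K).
      split; [lra|]. intros N X Y HN. split; intros HP.
      * enough (X N <= A + (B - A)) by lra.
        apply (polygon_final_upper_bound _ _ _ _ (B - A) _ _ _ HP HN).
        intros y Hy. apply Rabs_le_between in Hy.
        rewrite <- (Hpsiphi (B - A)). apply Hle. lra.
      * enough (A + (B - A) <= X N) by lra.
        apply (polygon_final_lower_bound _ _ _ _ (B - A) _ _ _ HP HN).
        intros y Hy. apply Rabs_le_between in Hy.
        rewrite <- (Hpsiphi (B - A)). apply Hle. lra.
    + exists u. apply (first_order_system_solution Phi psi f _ u w); try assumption.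
      split; lra.
  - intros alpha beta a b A B Ha Hb Hc Hd.
    (* Division by [alpha] and [a] gives [u 0 = c * u' 0 - A'] with [c = beta / alpha], and
       [a * (u 1 - B') + b * u' 1 = 0]. *)
    set (A' := A / alpha). set (B' := B / a).
    assert (EA : A = alpha * A') by (unfold A'; field; lra).
    assert (EB : B = a * B') by (unfold B'; field; lra).
    clearbody A' B'. subst A B.
    assert (PA := Rabs_pos A'). assert (PB := Rabs_pos B').
    assert (LA := Rle_abs A'). assert (LB := Rle_abs B').
    assert (NA := Rle_abs (- A')). assert (NB := Rle_abs (- B')). rewrite Rabs_Ropp in NA, NB.
    (* Since [M] exceeds [Rabs A'] and [Rabs B'], an endpoint value beyond [M] forces, by the
       positivity of the coefficients, a slope of the sign that excludes an extremum there. *)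
    set (M := r + 1 + Rabs A' + Rabs B').
    destruct (Hgrow' M) as [S0 [T0 [HS0 [HT0 HG]]]].
    pose (c := beta / alpha).
    assert (Hcpos : 0 < c) by (apply Rdiv_lt_0_compat; lra).
    assert (Ec : beta = alpha * c) by (unfold c; field; lra).
    clearbody c. subst beta.
    assert (Hsgn_pos : forall y, 0 < psi y -> 0 < y).
    { intros y Hy. apply Rnot_le_lt. intros Hn. apply Hle in Hn. lra. }
    assert (Hsgn_neg : forall y, psi y < 0 -> y < 0).
    { intros y Hy. apply Rnot_le_lt. intros Hn. apply Hle in Hn. lra. }
    destruct (bvp_exists psi (Derive Phi) H (fun s => c * psi s - A') f
      (fun x y => a * (x - B') + b * psi y) r M S0 T0)
      as [u [w [E0 [E1 [Du Dw]]]]]; try assumption.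
    + unfold M. lra.
    + intros s. apply (continuous_minus (fun s => c * psi s) (fun _ => A')).
      * apply (continuous_scal_r c psi). apply Cpsi.
      * apply continuous_const.
    + intros z. apply (continuous_plus (fun z : R * R => a * (fst z - B')) (fun z => b * psi (snd z))).
      * apply (continuous_scal_r a (fun z : R * R => fst z - B')).
        apply (continuous_minus (fun z : R * R => fst z) (fun _ => B')).
        -- apply continuous_fst.
        -- apply continuous_const.
      * apply (continuous_scal_r b (fun z : R * R => psi (snd z))).
        apply (continuous_comp (fun z : R * R => snd z) psi); [apply continuous_snd | apply Cpsi].
    + intros s Hs. unfold M in Hs. apply Hsgn_pos. nra.
    + intros s Hs. unfold M in Hs. apply Hsgn_neg. nra.
    + intros x y E Hx. unfold M in Hx. apply Hsgn_neg. nra.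
    + intros x y E Hx. unfold M in Hx. apply Hsgn_pos. nra.
    (* [v] is the initial slope for which the left condition gives [u 0 = B']. Starting at
       [w 0 <= - K] keeps all slopes nonpositive, and an initial slope at most [v] starts [u] at or
       below [B']; together both terms of [g] are nonpositive at time 1. The upper value [s2] is
       symmetric. *)
    + intros K HK. set (v := (A' + B') / c).
      assert (Ev : c * v = A' + B') by (unfold v; field; lra).
      exists (Rmin (- K) (Derive Phi v)), (Rmax K (Derive Phi v)).
      assert (R1 := Rmin_l (- K) (Derive Phi v)). assert (R2 := Rmin_r (- K) (Derive Phi v)).
      assert (R3 := Rmax_l K (Derive Phi v)). assert (R4 := Rmax_r K (Derive Phi v)).
      split; [lra|].
      set (s1 := Rmin (- K) (Derive Phi v)) in *. set (s2 := Rmax K (Derive Phi v)) in *.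
      apply Hle in R2, R4. rewrite Hpsiphi in R2, R4.
      intros N X Y HN. split; intros HP.
      * assert (G : forall y, Rabs (y - s1) <= K -> psi y <= 0).
        { intros y Hy. apply Rabs_le_between in Hy. rewrite <- psi0. apply Hle. lra. }
        assert (GX := polygon_final_upper_bound _ _ _ _ 0 _ _ _ HP HN G).
        assert (GY := G _ (proj1 (proj2 HP) N (le_n N))).
        assert (c * psi s1 <= c * v) by (apply Rmult_le_compat_l; lra).
        assert (0 <= a * (B' - X N)) by (apply Rmult_le_pos; lra).
        assert (0 <= b * - psi (Y N)) by (apply Rmult_le_pos; lra). lra.
      * assert (G : forall y, Rabs (y - s2) <= K -> 0 <= psi y).
        { intros y Hy. apply Rabs_le_between in Hy. rewrite <- psi0. apply Hle. lra. }
        assert (GX := polygon_final_lower_bound _ _ _ _ 0 _ _ _ HP HN G).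
        assert (GY := G _ (proj1 (proj2 HP) N (le_n N))).
        assert (c * v <= c * psi s2) by (apply Rmult_le_compat_l; lra).
        assert (0 <= a * (X N - B')) by (apply Rmult_le_pos; lra).
        assert (0 <= b * psi (Y N)) by (apply Rmult_le_pos; lra). lra.
    + exists u. apply (first_order_system_solution Phi psi f _ u w); try assumption.
      split; [rewrite E0; ring | lra].
Qed.
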